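(* Consider the model and dynamics described in the context, with constants $a>b>0$, $\alpha\in\mathbb{R}$, $\eta\in(0,1]$, $\lambda_n\to\infty$, and community-size limits $v^1,v^2\in(0,\infty)$. Assume that $v^1\ge v^2$ and, if $v^1>v^2$, that $$\frac{bv^1-av^2}{v^1-v^2}<\alpha<\frac{av^1-bv^2}{v^1-v^2}$$ (if $v^1=v^2$, $\alpha$ may be any real number). Let $\beta_n\in(0,\infty]$ satisfy $\lim_{n\to\infty}\frac{\beta_n\lambda_n}{\log\lambda_n}=\infty$. Let $t_n=c\log\lambda_n$ with $0<c<1/4$. Then $$\max\big\{|\boldsymbol{z}^1_n(t_n)-1|,\ |\boldsymbol{z}^2_n(t_n)+1|\big\}\Rightarrow0\quad\text{as }n\to\infty,$$ and this convergence also holds in expectation, i.e. $E\big[\max\{|\boldsymbol{z}^1_n(t_n)-1|,|\boldsymbol{z}^2_n(t_n)+1|\}\big]\to0$.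
   Context: Model: for each $n$, the node set $\mathcal{V}_n=\mathcal{V}_n^1\cup\mathcal{V}_n^2$ is a disjoint union of two communities of sizes $V_n^k=|\mathcal{V}_n^k|$ with $V_n^k/n\to v^k\in(0,\infty)$, $k=1,2$. The graph $\mathcal{G}_n$ on $\mathcal{V}_n$ is a stochastic block model: each unordered pair of distinct nodes is an edge independently, with probability $a_n=a\lambda_n/n$ if both nodes are in the same community and $b_n=b\lambda_n/n$ otherwise, where $a>b>0$ are constants and $\lambda_n\to\infty$. Write $u\sim v$ if $\{u,v\}$ is an edge. A configuration is a map $\sigma:\mathcal{V}_n\to\{-1,1\}$. Let $\alpha_n=\alpha\lambda_n/n$ and define $\Delta_n(\sigma,u)=2\sigma(u)\big[\sum_{v\sim u}\sigma(v)-\alpha_n\sum_{v\neq u}\sigma(v)\big]$. Let $r(x)=1/(1+e^x)$; when $\beta_n=\infty$ one uses the convention $r(\beta_n x)=\mathbf{1}\{x<0\}+\tfrac12\mathbf{1}\{x=0\}$. Dynamics (Glauber dynamics): given $\mathcal{G}_n$, $\boldsymbol{\sigma}_n(t)$ is the continuous-time Markov chain on configurations in which the spin of each node $u$ flips independently at rate $r(\beta_n\Delta_n(\boldsymbol{\sigma}_n(t),u))$. Initialization: independently for each node $u$, with probability $\eta$ the spin is set to $\boldsymbol{\sigma}_n(0,u)=\mathbf{1}\{u\in\mathcal{V}_n^1\}-\mathbf{1}\{u\in\mathcal{V}_n^2\}$, and otherwise $\boldsymbol{\sigma}_n(0,u)$ is uniform on $\{-1,1\}$. Magnetizations: $\boldsymbol{z}^k_n(t)=\frac{1}{V_n^k}\sum_{u\in\mathcal{V}_n^k}\boldsymbol{\sigma}_n(t,u)$.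 $\Rightarrow$ denotes weak convergence (here to a constant, i.e. convergence in probability). *)

(* Defs.v *)
From HB Require Import structures.
From mathcomp Require Import all_boot all_order all_algebra.
From mathcomp Require Import all_classical all_reals all_analysis.
Set Implicit Arguments. Unset Strict Implicit. Unset Printing Implicit Defensive.
Import Order.TTheory GRing.Theory Num.Theory.
Import numFieldNormedType.Exports.
Local Open Scope ring_scope.

(* Nodes of the n-th graph: 'I_N with N = V^1_n + V^2_n; node u is in
   community 1 iff u < k1 (k1 = V^1_n), otherwise in community 2. *)
Section Model.
Variable R : realType.

Definition config (N : nat) := {ffun 'I_N -> bool}.
(* a graph is given by the indicator of the edges {u,v} stored at (u,v), u<v *)
Definition graph (N : nat) := {ffun ('I_N * 'I_N) -> bool}.

Definition spin (b : bool) : R := if b then 1 else -1.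

Definition incomm1 (N k1 : nat) (u : 'I_N) : bool := (u < k1)%N.

Definition adj (N : nat) (G : graph N) (u v : 'I_N) : bool :=
  if (u < v)%N then G (u, v) else if (v < u)%N then G (v, u) else false.

Definition edge_prob (N k1 : nat) (pin pout : R) (p : 'I_N * 'I_N) : R :=
  if incomm1 k1 p.1 == incomm1 k1 p.2 then pin else pout.

Definition graph_law (N k1 : nat) (pin pout : R) (G : graph N) : R :=
  (\prod_(p : 'I_N * 'I_N | (p.1 < p.2)%N)
      (if G p then edge_prob k1 pin pout p else 1 - edge_prob k1 pin pout p))
  * (if [forall p : 'I_N * 'I_N, ~~ (p.1 < p.2)%N ==> ~~ G p] then 1 else 0).

(* initial law: independently, with prob. eta the planted spin
   (+1 on community 1, -1 on community 2), otherwise uniform *)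
Definition init_law (N k1 : nat) (eta : R) (s : config N) : R :=
  \prod_(u : 'I_N)
     (if s u == incomm1 k1 u then eta + (1 - eta) / 2 else (1 - eta) / 2).

Definition Delta (N : nat) (G : graph N) (alphan : R) (s : config N)
    (u : 'I_N) : R :=
  2 * spin (s u) * (\sum_(v | adj G u v) spin (s v)
                     - alphan * \sum_(v | v != u) spin (s v)).

(* r(beta x) with r(x) = 1/(1+e^x); for beta = +oo the indicator convention *)
Definition rate (beta : \bar R) (x : R) : R :=
  match beta with
  | EFin b => (1 + expR (b * x))^-1
  | +oo%E => ((x < 0)%R)%:R + 2^-1 * ((x == 0))%:R
  | -oo%E => 0
  end.

Definition flip (N : nat) (s : config N) (u : 'I_N) : config N :=
  [ffun v => if v == u then ~~ s v else s v].

Definition generator (N : nat) (G : graph N) (alphan : R) (beta : \bar R)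
    (s t : config N) : R :=
  \sum_(u : 'I_N) (if t == flip s u then rate beta (Delta G alphan s u) else 0)
  - (if t == s then \sum_(u : 'I_N) rate beta (Delta G alphan s u) else 0).

Fixpoint kpow (T : finType) (Q : T -> T -> R) (k : nat) : T -> T -> R :=
  match k with
  | 0 => fun s t => (s == t)%:R
  | k'.+1 => fun s t => \sum_(r : T) Q s r * kpow Q k' r t
  end.

Definition transition (N : nat) (G : graph N) (alphan : R) (beta : \bar R)
    (t : R) (s s' : config N) : R :=
  limn (fun m => \sum_(k < m) t ^+ k / (k`!)%:R
                   * kpow (generator G alphan beta) k s s').

Definition magn1 (N k1 : nat) (s : config N) : R :=
  (k1%:R)^-1 * \sum_(u | incomm1 k1 u) spin (s u).
Definition magn2 (N k1 : nat) (s : config N) : R :=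
  ((N - k1)%:R)^-1 * \sum_(u | ~~ incomm1 k1 u) spin (s u).

Definition err (N k1 : nat) (s : config N) : R :=
  Num.max `|magn1 k1 s - 1| `|magn2 k1 s + 1|.

Definition dyn_expect (N k1 : nat) (pin pout eta alphan : R) (beta : \bar R)
    (t : R) (F : config N -> R) : R :=
  \sum_(G : graph N) \sum_(s0 : config N) \sum_(s : config N)
     graph_law k1 pin pout G * init_law k1 eta s0
     * transition G alphan beta t s0 s * F s.

End Model.

(* Main.v *)
(** Let [x_u] indicate that the spin of [u] differs from its planted value, and
    [D] be the sum of the [x_u]. As long as the averaged local fields point in
    the planted direction, the flip rate of [u] is close to [x_u], up to the
    fluctuation [dev_u] of the edges at [u]; so [D] decays at rate 1 under the
    generator. An exponential moment bound and a union over all pairs of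
    configurations give, with overwhelming probability, [sum_u |dev_u(s)| <=
    K n sqrt(lam)] for every configuration [s] at once, which decouples the
    dynamics from the randomness of the graph. The averaged fields are
    [eta H_k - y_k] with [y_k] of mean 0 initially; the function
    [min(1, theta^-2 sum_k max(0, y_k)^2)] has drift at most of order
    [lam^(-1/2)], so with probability tending to 1 the fields keep their sign
    until the time [c log lam]. Both drift inequalities are integrated through
    [exp(tL) = exp(-Lam t) exp(t (Lam + L))], where [Lam + L] is a nonnegative
    matrix. The result is [E err = O(lam^(-c))]. *)
Require Import Defs.
From HB Require Import structures.
From mathcomp Require Import all_boot all_order all_algebra.
From mathcomp Require Import all_classical all_reals all_analysis.
From mathcomp Require Import ring lra.
Import Order.TTheory GRing.Theory Num.Theory.
Import numFieldNormedType.Exports.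
Local Open Scope classical_set_scope.
Local Open Scope ring_scope.
Set Implicit Arguments.
Unset Strict Implicit.
Unset Printing Implicit Defensive.

(** * Cauchy products of exponential series *)

Section ExpSeries.
Variable R : realType.
Implicit Types (x y t : R) (u v : nat -> R).

Lemma sum_exp_coeff_le x m : 0 <= x -> \sum_(k < m) exp_coeff x k <= expR x.
Proof.
move=> x0; rewrite -(big_mkord xpredT (exp_coeff x)).
apply: (nondecreasing_cvgn_le (u_ := series (exp_coeff x))).
  by apply: nondecreasing_series => i _ _; exact: exp_coeff_ge0.
exact: is_cvg_series_exp_coeff.
Qed.

(* The ratio 1/8 leaves room for the [m ^ 2] terms dropped in [cauchy_product]. *)
Lemma exp_coeff_geometric x i : `|exp_coeff x i| <= expR (8 * `|x|) * 8^-1 ^+ i.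
Proof.
have h : exp_coeff (8 * `|x|) i <= expR (8 * `|x|).
  have x8 : 0 <= 8 * `|x| by rewrite mulr_ge0.
  apply: le_trans (sum_exp_coeff_le i.+1 x8).
  rewrite big_ord_recr /= lerDr sumr_ge0 // => j _; exact: exp_coeff_ge0.
rewrite exprVn ler_pdivlMr ?exprn_gt0//.
apply: le_trans h; rewrite /exp_coeff /= normrM normrX normfV [`|_%:R|]ger0_norm//.
by rewrite exprMn mulrAC (mulrC (8 ^+ i)).
Qed.

Lemma triangular_sum u v m :
  \sum_(k < m) \sum_(i < k.+1) u i * v (k - i)%N =
  \sum_(i < m) u i * \sum_(j < m - i) v j.
Proof.
elim: m => [|m IH]; first by rewrite !big_ord0.
rewrite big_ord_recr /= {}IH.
rewrite [in RHS]big_ord_recr /= [in LHS](big_ord_recr m) /= subnn subSnn.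
rewrite big_ord_recl big_ord0 addr0 addrA; congr (_ + _).
rewrite -big_split; apply: eq_bigr => i _ /=.
by rewrite -mulrDr subSn ?(ltnW (ltn_ord i))// big_ord_recr.
Qed.

(** The product of the partial sums differs from the triangular sum by the terms [u i * v j] with
    [i, j < m] and [i + j >= m]: at most [m ^ 2] terms, each at most [K * K' * 8 ^- m]. *)
Lemma cauchy_product u v (K K' l l' : R) :
  (forall i, `|u i| <= K * 8^-1 ^+ i) -> (forall i, `|v i| <= K' * 8^-1 ^+ i) ->
  \sum_(i < m) u i @[m --> \oo] --> l -> \sum_(i < m) v i @[m --> \oo] --> l' ->
  \sum_(k < m) \sum_(i < k.+1) u i * v (k - i)%N @[m --> \oo] --> l * l'.
Proof.
move=> hu hv cu cv.
have K0 : 0 <= K by have := hu 0%N; rewrite expr0 mulr1; apply: le_trans.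
have K'0 : 0 <= K' by have := hv 0%N; rewrite expr0 mulr1; apply: le_trans.
have key m : `|(\sum_(i < m) u i) * (\sum_(i < m) v i)
   - \sum_(k < m) \sum_(i < k.+1) u i * v (k - i)%N| <= K * K' * 2^-1 ^+ m.
  rewrite triangular_sum mulr_suml -sumrB.
  apply: (le_trans (ler_norm_sum _ _ _)).
  have step (i : 'I_m) : `|u i * (\sum_(j < m) v j) - u i * \sum_(j < m - i) v j|
      <= K * K' * (m%:R * 8^-1 ^+ m).
    have im := ltnW (ltn_ord i).
    rewrite -mulrBr normrM.
    have -> : \sum_(j < m) v j - \sum_(j < m - i) v j =
        \sum_(m - i <= j < m) v j.
      rewrite -!(big_mkord xpredT v) (big_cat_nat (leq0n (m - i)%N) (leq_subr i m)) /=.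
      by rewrite addrAC subrr add0r.
    have h2 : `|\sum_(m - i <= j < m) v j| <= m%:R * (K' * 8^-1 ^+ (m - i)).
      apply: (le_trans (ler_norm_sum _ _ _)).
      apply: (@le_trans _ _ (\sum_(m - i <= j < m) (K' * 8^-1 ^+ (m - i)))).
        rewrite big_nat [X in _ <= X]big_nat; apply: ler_sum => j /andP[h _].
        apply: (le_trans (hv j)); apply: ler_wpM2l => //.
        by apply: ler_wiXn2l => //; rewrite ?invr_ge0 ?invf_le1 ?ler1n.
      rewrite sumr_const_nat subKn// -[X in X <= _]mulr_natl; apply: ler_wpM2r.
        by rewrite mulr_ge0// exprn_ge0.
      by rewrite ler_nat.
    apply: (le_trans (ler_pM (normr_ge0 _) (normr_ge0 _) (hu i) h2)).
    rewrite le_eqVlt; apply/orP; left; apply/eqP.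
    have -> : (8^-1 : R) ^+ m = 8^-1 ^+ i * 8^-1 ^+ (m - i) by rewrite -exprD subnKC.
    by ring.
  apply: (@le_trans _ _ (\sum_(i < m) K * K' * (m%:R * 8^-1 ^+ m))).
    by apply: ler_sum => i _; exact: step.
  rewrite sumr_const card_ord -mulrnAr; apply: ler_wpM2l; first exact: mulr_ge0.
  rewrite -[X in X <= _]mulr_natl.
  (* Two of the three factors absorb [m ^ 2] through [m <= 2 ^ m]; the third gives the decay. *)
  have -> : (8^-1 : R) ^+ m = 2^-1 ^+ m * 2^-1 ^+ m * 2^-1 ^+ m.
    by rewrite -!exprMn; congr (_ ^+ m); field.
  rewrite !mulrA -[X in _ <= X]mul1r; apply: ler_wpM2r; first by rewrite exprn_ge0// invr_ge0.
  have h : m%:R * 2^-1 ^+ m <= 1 :> R.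
    rewrite exprVn ler_pdivrMr ?exprn_gt0// mul1r -natrX ler_nat.
    exact: (ltnW (ltn_expl _ _)).
  have -> : m%:R * m%:R * 2^-1 ^+ m * 2^-1 ^+ m = (m%:R * 2^-1 ^+ m) * (m%:R * 2^-1 ^+ m) :> R by ring.
  by rewrite mulr_ile1// mulr_ge0// exprn_ge0// invr_ge0.
have c0 : (\sum_(i < m) u i) * (\sum_(i < m) v i)
   - \sum_(k < m) \sum_(i < k.+1) u i * v (k - i)%N @[m --> \oo] --> (0:R).
  apply/cvgr0Pnorm_le => e e0.
  have cg : K * K' * 2^-1 ^+ m @[m --> \oo] --> (0 : R).
    rewrite -(mulr0 (K * K')); apply: cvgM; first exact: cvg_cst.
    by apply: cvg_expr; rewrite ger0_norm ?invr_ge0// invf_lt1// ltr1n.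
  move/cvgr0Pnorm_le : cg => /(_ _ e0); apply: filterS => m.
  by move=> h; apply: le_trans (key m) (le_trans (ler_norm _) h).
have cc := cvgB (cvgM cu cv) c0; rewrite subr0 in cc.
apply: cvg_trans (cc _ _); apply: near_eq_cvg; apply: nearW => m /=.
by rewrite !fctE /= subKr.
Qed.

End ExpSeries.

(** * Uniformization of the matrix exponential *)

Section Uniformization.
Variables (R : realType) (T : finType) (Q : T -> T -> R) (Lam : R).
Implicit Types (f g : T -> R) (s : T) (tau : R).

Definition kernel_op (K : T -> T -> R) f s : R := \sum_r K s r * f r.

(* Uniformization: adding [Lam] on the diagonal of a generator makes it nonnegative. *)
Definition unif_kernel s r : R := Q s r + Lam * (s == r)%:R.

(** For [Q] the generator of the dynamics this is convertible to [transition]; the semigroup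
    argument is carried out for a general finite matrix. *)
Definition exp_kernel (tau : R) s s' : R :=
  limn (fun m => \sum_(k < m) tau ^+ k / (k`!)%:R * kpow Q k s s').

Hypothesis B_ge0 : forall s r, 0 <= unif_kernel s r.
Hypothesis Q_row0 : forall s, \sum_r Q s r = 0.
Hypothesis Lam_ge1 : 1 <= Lam.

Let B := unif_kernel.
Let Lam_ge0 : 0 <= Lam := le_trans ler01 Lam_ge1.

Lemma kernel_op_sum (K : T -> T -> R) n (F : nat -> T -> R) (c : nat -> R) s :
  kernel_op K (fun r => \sum_(i < n) c i * F i r) s = \sum_(i < n) c i * kernel_op K (F i) s.
Proof.
rewrite /kernel_op; under eq_bigr do rewrite mulr_sumr.
rewrite exchange_big; apply: eq_bigr => i _ /=.
by rewrite mulr_sumr; apply: eq_bigr => r _; rewrite mulrCA.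
Qed.

Lemma kernel_op_unif f s : kernel_op B f s = kernel_op Q f s + Lam * f s.
Proof.
rewrite /kernel_op /B /unif_kernel; under eq_bigr do rewrite mulrDl.
rewrite big_split /=; congr (_ + _).
rewrite (bigD1 s)//= eqxx mulr1 big1 ?addr0// => r rs.
by rewrite eq_sym (negbTE rs) mulr0 mul0r.
Qed.

Lemma kpow_unif_ge0 k s s' : 0 <= kpow B k s s'.
Proof.
elim: k s => [|k IH] s /=; first by rewrite ler0n.
by apply: sumr_ge0 => r _; rewrite mulr_ge0.
Qed.

Lemma unif_row s : \sum_r B s r = Lam.
Proof.
have := kernel_op_unif (fun=> 1) s; rewrite /kernel_op.
under eq_bigr do rewrite mulr1.
by under [in X in _ = X -> _]eq_bigr do rewrite mulr1; rewrite Q_row0 mulr1 add0r.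
Qed.

Lemma kpow_unif_le k s s' : kpow B k s s' <= Lam ^+ k.
Proof.
elim: k s => [|k IH] s /=; first by rewrite expr0 lern1 leq_b1.
rewrite exprS -[X in X * _](unif_row s) mulr_suml.
by apply: ler_sum => r _; apply: ler_wpM2l.
Qed.

(** Binomial theorem for [Q = B - Lam * I], whose two terms commute; division by [k!] turns it into
    the coefficient of a Cauchy product. *)
Lemma kpow_binomial k s s' :
  kpow Q k s s' / (k`!)%:R =
  \sum_(i < k.+1) (exp_coeff (- Lam) i * (kpow B (k - i) s s' / ((k - i)`!)%:R)).
Proof.
have fne n : (n`!)%:R != 0 :> R by rewrite pnatr_eq0 -lt0n fact_gt0.
elim: k s => [|k IH] s.
  by rewrite big_ord_recl big_ord0 /= /exp_coeff /= expr0 fact0 !divr1 mul1r addr0.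
have kne : k.+1%:R != 0 :> R by rewrite pnatr_eq0.
have -> : kpow Q k.+1 s s' / (k.+1)`!%:R =
    (k.+1%:R)^-1 * (kernel_op B (fun r => kpow Q k r s' / k`!%:R) s
       - Lam * (kpow Q k s s' / k`!%:R)).
  rewrite kernel_op_unif addrK /kernel_op factS natrM invfM mulrCA /= mulr_suml mulr_sumr.
  by rewrite mulr_sumr; apply: eq_bigr => r _; rewrite !mulrA.
apply: (mulfI kne); rewrite mulVKf//.
have -> : (fun r => kpow Q k r s' / k`!%:R) = (fun r => \sum_(i < k.+1)
   (exp_coeff (- Lam) i * (kpow B (k - i) r s' / ((k - i)`!)%:R))) by apply/funext.
rewrite (kernel_op_sum B k.+1 (fun i r => kpow B (k - i) r s' / ((k - i)`!)%:R)).
(* After multiplication by [k + 1], this factor is split as [(k + 1 - i) + i]: the product with [B]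
   supplies the first part, the product with [- Lam] the second. *)
rewrite IH [X in X - _](_ : _ = \sum_(i < k.+2)
   (k.+1 - i)%:R * (exp_coeff (- Lam) i * (kpow B (k.+1 - i) s s' / (k.+1 - i)`!%:R))); last first.
  rewrite [RHS]big_ord_recr /= subnn mul0r addr0; apply: eq_bigr => i _.
  rewrite subSn ?leq_ord//= mulrCA; congr (_ * _).
  rewrite factS natrM invfM mulrCA mulVKf ?pnatr_eq0// /kernel_op mulr_suml.
  by apply: eq_bigr => r _; rewrite mulrA.
rewrite -mulNr.
rewrite [X in _ + X](_ : _ = \sum_(i < k.+2)
   i%:R * (exp_coeff (- Lam) i * (kpow B (k.+1 - i) s s' / (k.+1 - i)`!%:R))); last first.
  rewrite [RHS]big_ord_recl /= mul0r add0r mulr_sumr; apply: eq_bigr => i _.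
  rewrite /bump /= add1n subSS !mulrA; congr (_ * _ * _).
  rewrite /exp_coeff /= exprS factS natrM invfM.
  by field; rewrite fne /= nat1r pnatr_eq0.
rewrite -big_split mulr_sumr; apply: eq_bigr => i _ /=.
by rewrite -mulrDl -natrD subnK// -ltnS.
Qed.

Lemma series_kpow_unif_bound tau s s' j : 0 <= tau ->
  `|tau ^+ j * (kpow B j s s' / j`!%:R)| <= expR (8 * (Lam * tau)) * 8^-1 ^+ j.
Proof.
move=> tau0; have := exp_coeff_geometric (Lam * tau) j.
rewrite [`|Lam * tau|]ger0_norm ?mulr_ge0//; apply: le_trans.
rewrite /exp_coeff /= mulrA !normrM; apply: ler_wpM2r => //.
rewrite -normrM !ger0_norm ?mulr_ge0 ?exprn_ge0 ?kpow_unif_ge0 ?mulr_ge0//.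
rewrite exprMn mulrC; apply: ler_wpM2r; first exact: exprn_ge0.
exact: kpow_unif_le.
Qed.

Lemma is_cvg_kpow_unif tau s s' : 0 <= tau ->
  cvgn (fun m => \sum_(j < m) tau ^+ j * (kpow B j s s' / j`!%:R)).
Proof.
move=> tau0.
have t0 j : 0 <= tau ^+ j * (kpow B j s s' / j`!%:R).
  by rewrite mulr_ge0 ?exprn_ge0// divr_ge0// kpow_unif_ge0.
apply: nondecreasing_is_cvgn.
  apply/nondecreasing_seqP => m; rewrite big_ord_recr /= lerDl; exact: t0.
exists (expR (Lam * tau)) => _ [m _ <-].
apply: le_trans (sum_exp_coeff_le m (mulr_ge0 Lam_ge0 tau0)).
apply: ler_sum => j _; rewrite /exp_coeff /= mulrA; apply: ler_wpM2r; first by rewrite invr_ge0.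
by rewrite exprMn mulrC; apply: ler_wpM2r; [exact: exprn_ge0|exact: kpow_unif_le].
Qed.

(** [exp(tau Q) = exp(- Lam tau) exp(tau B)], by [kpow_binomial] and [cauchy_product]. The series on
    the right has nonnegative terms, so inequalities on powers of [B] pass to the kernel. *)
Lemma exp_kernel_unif tau s s' : 0 <= tau ->
  exp_kernel tau s s' = expR (- (Lam * tau)) *
    limn (fun m => \sum_(j < m) tau ^+ j * (kpow B j s s' / j`!%:R)).
Proof.
move=> tau0; apply/cvg_lim => //.
set u := exp_coeff (- (Lam * tau)).
set v := fun j => tau ^+ j * (kpow B j s s' / j`!%:R).
have cu : \sum_(i < m) u i @[m --> \oo] --> expR (- (Lam * tau)).
  rewrite (_ : (fun m => _) = series u); first exact: is_cvg_series_exp_coeff.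
  by apply/funext => m; rewrite /series /= big_mkord.
have cv := @is_cvg_kpow_unif tau s s' tau0.
have cc := cauchy_product (exp_coeff_geometric _)
  (fun j => @series_kpow_unif_bound tau s s' j tau0) cu cv.
apply: cvg_trans cc; apply: near_eq_cvg; apply: nearW => m /=.
apply: eq_bigr => k _; rewrite -mulrA [_^-1 * _]mulrC kpow_binomial mulr_sumr.
apply: eq_bigr => i _; rewrite /u /exp_coeff /= -mulNr exprMn.
have -> : tau ^+ k = tau ^+ i * tau ^+ (k - i) by rewrite -exprD subnKC// -ltnS.
by ring.
Qed.

End Uniformization.

(** * Drift inequalities integrated along the semigroup *)

Section SemigroupBound.
Variables (R : realType) (T : finType) (Q : T -> T -> R) (Lam : R).
Hypothesis B_ge0 : forall s r, 0 <= unif_kernel Q Lam s r.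
Hypothesis Q_row0 : forall s, \sum_r Q s r = 0.
Hypothesis Lam_ge1 : 1 <= Lam.

Let B := unif_kernel Q Lam.
Let Lam_ge0 : 0 <= Lam := le_trans ler01 Lam_ge1.

Lemma exp_kernel_ge0 (tau : R) s s' : 0 <= tau -> 0 <= exp_kernel Q tau s s'.
Proof.
move=> tau0; rewrite (exp_kernel_unif B_ge0 Q_row0 Lam_ge1)//.
rewrite mulr_ge0 ?expR_ge0// limr_ge//; first exact: is_cvg_kpow_unif.
apply: nearW => m; apply: sumr_ge0 => j _.
by rewrite mulr_ge0 ?exprn_ge0// divr_ge0// kpow_unif_ge0.
Qed.

Lemma exp_kernel_mono (tau : R) (f g : T -> R) s : 0 <= tau ->
  (forall r, f r <= g r) ->
  \sum_r exp_kernel Q tau s r * f r <= \sum_r exp_kernel Q tau s r * g r.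
Proof.
by move=> tau0 fg; apply: ler_sum => r _; rewrite ler_wpM2l ?exp_kernel_ge0.
Qed.

Variables (f psi : T -> R) (e d : R).
Hypothesis f_ge0 : forall s, 0 <= f s.
Hypothesis psi_ge0 : forall s, 0 <= psi s.
Hypothesis e_ge0 : 0 <= e.
Hypothesis d_ge0 : 0 <= d.
Hypothesis f_drift : forall s, kernel_op Q f s <= - f s + e + psi s.
Hypothesis psi_drift : forall s, kernel_op Q psi s <= d.

(** Induction from [B f <= (Lam - 1) f + e + psi] and [B psi <= Lam psi + d]; [Lam >= 1] keeps the
    first coefficient nonnegative. Each step adds [d] times the coefficient of [psi], which is at
    most [Lam ^ k], whence the last summand. *)
Lemma kpow_unif_drift k s :
  \sum_r kpow B k s r * f r <=
  (Lam - 1) ^+ k * f s + (Lam ^+ k - (Lam - 1) ^+ k) * (e + psi s)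
  + d * (k%:R * Lam ^+ k.-1).
Proof.
have L1 : 0 <= Lam - 1 by rewrite subr_ge0.
elim: k s => [|k IH] s.
  rewrite /= !expr0 subrr !mul0r mulr0 !addr0 mul1r (bigD1 s)//= eqxx mul1r.
  by rewrite big1 ?addr0// => r rs; rewrite eq_sym (negbTE rs) mul0r.
have -> : \sum_r kpow B k.+1 s r * f r = \sum_r B s r * \sum_r' kpow B k r r' * f r'.
  under eq_bigr do rewrite /= mulr_suml.
  rewrite exchange_big /=; apply: eq_bigr => r _; rewrite mulr_sumr.
  by apply: eq_bigr => r' _; rewrite mulrA.
apply: (@le_trans _ _ (\sum_r B s r * ((Lam - 1) ^+ k * f r
   + (Lam ^+ k - (Lam - 1) ^+ k) * (e + psi r) + d * (k%:R * Lam ^+ k.-1)))).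
  by apply: ler_sum => r _; apply: ler_wpM2l => //; exact: B_ge0.
set C := Lam ^+ k - _; set E := d * (k%:R * _).
have -> : \sum_r B s r * ((Lam - 1) ^+ k * f r + C * (e + psi r) + E) =
    (Lam - 1) ^+ k * (kernel_op Q f s + Lam * f s) + C * (Lam * e + (kernel_op Q psi s + Lam * psi s)) + E * Lam.
  rewrite -!(kernel_op_unif Q Lam); set p := (Lam - 1) ^+ k.
  transitivity (p * kernel_op B f s + C * ((\sum_r B s r) * e + kernel_op B psi s)
     + E * \sum_r B s r); last by rewrite (unif_row Lam Q_row0 s).
  rewrite /kernel_op mulr_suml -big_split !mulr_sumr -!big_split /=; apply: eq_bigr => r _.
  by ring.
have C0 : 0 <= C by rewrite subr_ge0 lerXn2r// ?nnegrE// gerBl.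
have Cle : C <= Lam ^+ k by rewrite gerBl exprn_ge0.
have h1 := ler_wpM2l (exprn_ge0 k L1) (f_drift s).
have h2 := ler_wpM2l C0 (psi_drift s).
have h3 := ler_wpM2r d_ge0 Cle.
(* For [k = 0] the default [k.-1 = 0] is harmless, since the factor [k%:R] is 0. *)
have hE : E * Lam = d * (k%:R * Lam ^+ k).
  by rewrite /E; case: k {IH C E C0 Cle h1 h2 h3} => [|k]; rewrite ?mul0r ?mulr0 ?mul0r// exprSr; ring.
rewrite hE -[k.+1%:R]natr1 /= !exprS; rewrite -/C.
have -> : Lam * Lam ^+ k - (Lam - 1) * (Lam - 1) ^+ k = Lam * C + (Lam - 1) ^+ k.
  by rewrite /C; ring.
move: h1 h2 h3; set p := (Lam - 1) ^+ k; set q := Lam ^+ k.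
set x := kernel_op Q f s; set y := kernel_op Q psi s => h1 h2 h3.
have -> : p * (x + Lam * f s) + C * (Lam * e + (y + Lam * psi s)) + d * (k%:R * q) =
   p * x + (C * y) + (p * Lam * f s + C * Lam * (e + psi s) + d * k%:R * q) by ring.
have -> : (Lam - 1) * p * f s + (Lam * C + p) * (e + psi s) + d * ((k%:R + 1) * q) =
   p * (- f s + e + psi s) + q * d + (p * Lam * f s + C * Lam * (e + psi s) + d * k%:R * q) by ring.
by lra.
Qed.

(** [kpow_unif_drift] is summed against [exp(- Lam tau) tau ^ k / k!]. The powers of [Lam - 1] sum
    to [exp(- tau)], those of [Lam] to 1, and the terms [k * Lam ^ (k - 1)] to [tau]. *)
Lemma semigroup_bound (tau : R) s : 0 <= tau ->
  \sum_r exp_kernel Q tau s r * f r <= expR (- tau) * f s + e + psi s + d * tau.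
Proof.
move=> tau0.
have L1 : 0 <= Lam - 1 by rewrite subr_ge0.
have cv r := @is_cvg_kpow_unif _ _ _ _ B_ge0 Q_row0 Lam_ge1 tau s r tau0.
pose S r m : R := \sum_(j < m) tau ^+ j * (kpow B j s r / j`!%:R).
have -> : \sum_r exp_kernel Q tau s r * f r =
    expR (- (Lam * tau)) * limn (fun m => \sum_r S r m * f r).
  under eq_bigr do rewrite (exp_kernel_unif B_ge0 Q_row0 Lam_ge1)//.
  have -> : limn (fun m => \sum_r S r m * f r) = \sum_r limn (S r) * f r.
    apply/cvg_lim => //; apply: (@cvg_big _ _ +%R) => //; first exact: add_continuous.
    by move=> r _; apply: cvgM; [exact: cv|exact: cvg_cst].
  by rewrite mulr_sumr; apply: eq_bigr => r _; rewrite mulrA.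
have -> : expR (- tau) * f s + e + psi s + d * tau =
   expR (- (Lam * tau)) * (expR ((Lam - 1) * tau) * f s +
       expR (Lam * tau) * (e + psi s) + d * (tau * expR (Lam * tau))).
  have h : expR (- (Lam * tau)) * expR (Lam * tau) = 1 by rewrite -expRD addNr expR0.
  have -> : expR (- tau) = expR (- (Lam * tau)) * expR ((Lam - 1) * tau).
    by rewrite -expRD; congr expR; ring.
  move: h; set x := expR _; set y := expR _ => h.
  transitivity (x * expR ((Lam - 1) * tau) * f s + (x * y) * (e + psi s) + d * tau * (x * y));
    by [rewrite h; ring|ring].
apply: ler_wpM2l; first exact: expR_ge0.
apply: limr_le.
  apply: (cvgP (\sum_r limn (S r) * f r)).
  apply: (@cvg_big _ _ +%R) => //; first exact: add_continuous.
  by move=> r _; apply: cvgM; [exact: cv|exact: cvg_cst].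
apply: nearW => m.
have -> : \sum_r S r m * f r = \sum_(j < m) tau ^+ j / j`!%:R * \sum_r kpow B j s r * f r.
  rewrite /S; under eq_bigr do rewrite mulr_suml.
  rewrite exchange_big; apply: eq_bigr => j _ /=; rewrite mulr_sumr.
  by apply: eq_bigr => r _; ring.
apply: (@le_trans _ _ (\sum_(j < m) (exp_coeff ((Lam - 1) * tau) j * f s
    + exp_coeff (Lam * tau) j * (e + psi s) + d * (j%:R * Lam ^+ j.-1 * tau ^+ j / j`!%:R)))).
  apply: ler_sum => j _.
  have c0 : 0 <= tau ^+ j / j`!%:R by rewrite divr_ge0// exprn_ge0.
  apply: (le_trans (ler_wpM2l c0 (kpow_unif_drift j s))).
  rewrite /exp_coeff /= !exprMn.
  (* This is the negative contribution of [- (Lam - 1) ^ j * (e + psi s)], which is dropped. *)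
  have : 0 <= tau ^+ j / j`!%:R * ((Lam - 1) ^+ j * (e + psi s)).
    by rewrite mulr_ge0// mulr_ge0 ?exprn_ge0// addr_ge0.
  set p := (Lam - 1) ^+ j; set q := Lam ^+ j; set c := _ ^+ j.-1; set w := _^-1 => h.
  rewrite -subr_ge0; apply: le_trans h _; rewrite le_eqVlt; apply/orP; left; apply/eqP.
  by ring.
rewrite !big_split /= -!mulr_suml -mulr_sumr.
apply: lerD; first apply: lerD.
- by apply: ler_wpM2r => //; apply: sum_exp_coeff_le; exact: mulr_ge0.
- by apply: ler_wpM2r; [exact: addr_ge0|apply: sum_exp_coeff_le; exact: mulr_ge0].
apply: ler_wpM2l => //.
case: m => [|m]; first by rewrite big_ord0 mulr_ge0 ?expR_ge0.
(* The term of index 0 vanishes; cancelling [j] against [j!] shifts the series and leaves a factor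
   [tau]. *)
rewrite big_ord_recl /= !mul0r add0r.
apply: (@le_trans _ _ (\sum_(i < m) tau * exp_coeff (Lam * tau) i)).
  apply: ler_sum => i _; rewrite /bump /= add1n /exp_coeff /= exprMn exprS factS natrM.
  rewrite le_eqVlt; apply/orP; left; apply/eqP.
  by field; rewrite nat1r pnatr_eq0 pnatr_eq0 -lt0n fact_gt0.
by rewrite -mulr_sumr ler_wpM2l// sum_exp_coeff_le// mulr_ge0.
Qed.

End SemigroupBound.

(** * Symmetry and monotonicity of the flip rates *)

Section FlipRates.
Variables (R : realType) (beta : \bar R).
Hypothesis beta_gt0 : (0 < beta)%E.

Lemma rate_ge0 x : 0 <= rate beta x.
Proof.
by case: beta => [b||] //=; rewrite invr_ge0 addr_ge0// expR_ge0.
Qed.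

(** At infinite [beta] the value 1/2 at 0 is what secures this symmetry. It reduces mismatched nodes
    to nodes with the planted spin. *)
Lemma rateN x : rate beta (- x) = 1 - rate beta x.
Proof.
case: beta beta_gt0 => [b||] //= _.
  rewrite mulrN expRN; have := expR_gt0 (b * x); set y := expR _ => y0.
  by field; rewrite !gt_eqF// addr_gt0.
by rewrite oppr_lt0 oppr_eq0; case: ltgtP => _ /=; lra.
Qed.

Lemma rate_le1 x : rate beta x <= 1.
Proof. by rewrite -subr_ge0 -rateN rate_ge0. Qed.

Lemma rate_nincr x y : x <= y -> rate beta y <= rate beta x.
Proof.
case: beta beta_gt0 => [b||] //= b0 xy.
  rewrite lef_pV2 ?posrE ?addr_gt0 ?expR_gt0// lerD2l ler_expR ler_wpM2l//.
  by rewrite ltW.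
by case: (ltgtP y 0); case: (ltgtP x 0) => //= h1 h2; lra.
Qed.

End FlipRates.

(** * The generator of the Glauber dynamics *)

Section Generator.
Variables (R : realType) (N : nat) (G : graph N) (alphan : R) (beta : \bar R).
Implicit Types (s r : config N) (f : config N -> R).

Local Notation q s u := (rate beta (Delta G alphan s u)).

Lemma generator_op f s :
  kernel_op (generator G alphan beta) f s = \sum_u q s u * (f (flip s u) - f s).
Proof.
rewrite /kernel_op /generator; under eq_bigr do rewrite mulrBl mulr_suml.
rewrite sumrB exchange_big /=.
have pick (t : config N) (c : R) : \sum_r (if r == t then c else 0) * f r = c * f t.
  by rewrite (bigD1 t)//= eqxx big1 ?addr0// => r /negbTE->; rewrite mul0r.
rewrite pick mulr_suml -sumrB; apply: eq_bigr => u _.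
by rewrite pick mulrBr.
Qed.

Lemma generator_row0 s : \sum_r generator G alphan beta s r = 0.
Proof.
have := generator_op (fun=> 1) s; rewrite /kernel_op.
under eq_bigr do rewrite mulr1; move=> ->.
by rewrite big1// => u _; rewrite subrr mulr0.
Qed.

Hypothesis beta_gt0 : (0 < beta)%E.

(** The total flip rate is at most [N], each rate being at most 1. The choice [N.+1] also ensures
    [Lam >= 1], whatever [N]. *)
Lemma generator_unif_ge0 s r :
  0 <= unif_kernel (generator G alphan beta) N.+1%:R s r.
Proof.
rewrite /unif_kernel /generator [s == r]eq_sym -addrA.
apply: addr_ge0.
  by apply: sumr_ge0 => u _; case: ifP => // _; exact: rate_ge0.
case: ifP => _; last by rewrite oppr0 add0r mulr0.
rewrite mulr1 addrC subr_ge0.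
apply: (@le_trans _ _ (\sum_(u < N) 1)); first by apply: ler_sum => u _; exact: rate_le1.
by rewrite sumr_const card_ord ler_nat.
Qed.

End Generator.

(** * Mean-field decomposition of the local fields *)

Section MeanField.
Variables (R : realType) (N k1 : nat) (pin pout alphan eta : R).
Implicit Types (s : config N) (u v : 'I_N) (k : bool).

Definition mismatch s u : R := (s u != incomm1 k1 u)%:R.

(** Mean contribution of [v] to the field at a node of community [k], signed so that it is positive
    when a planted [v] supports the planted spin of [k]; hence the reversed difference across
    communities. *)
Definition coupling k v : R :=
  if incomm1 k1 v == k then pin - alphan else alphan - pout.

(* [1 - eta] is the mean of [2 * mismatch] under the initial law. *)
Definition excess s v : R := 2 * mismatch s v - (1 - eta).

(** The loss of averaged field relative to its initial mean: the field in the planted direction is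
    [eta * \sum_v coupling k v - drop k s]. *)
Definition drop k s : R := \sum_v coupling k v * excess s v.

Definition deviation (G : graph N) s u : R :=
  \sum_(v | v != u) ((adj G u v)%:R - edge_prob k1 pin pout (u, v)) * spin R (s v).

Lemma mismatch01 s u : mismatch s u = 0 \/ mismatch s u = 1.
Proof. by rewrite /mismatch; case: (_ != _); [right|left]. Qed.

Lemma adj_irrefl (G : graph N) u : adj G u u = false.
Proof. by rewrite /adj ltnn. Qed.

(** Each edge indicator is its mean plus a centred part, and the centred parts form [deviation]. The
    last term removes the self-interaction [v = u], which the full sums include. *)
Lemma local_field (G : graph N) s u : let k := incomm1 k1 u in
  \sum_(v | adj G u v) spin R (s v) - alphan * \sum_(v | v != u) spin R (s v) =
  deviation G s u + spin R k * (eta * \sum_v coupling k v - drop k s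
    - coupling k u * (1 - 2 * mismatch s u)).
Proof.
move=> k.
have -> : \sum_(v | adj G u v) spin R (s v) =
    \sum_(v | v != u) (adj G u v)%:R * spin R (s v).
  rewrite big_mkcond [RHS]big_mkcond; apply: eq_bigr => v _.
  have [->|vu] := eqVneq v u; first by rewrite adj_irrefl.
  by case: adj; rewrite ?mul1r ?mul0r.
have -> : eta * \sum_v coupling k v - drop k s = \sum_v coupling k v * (1 - 2 * mismatch s v).
  by rewrite /drop mulr_sumr -sumrB; apply: eq_bigr => v _; rewrite /excess; ring.
rewrite [X in _ * (X - _)](bigD1 u)//= addrAC subrr add0r /deviation !mulr_sumr -sumrB -big_split /=.
apply: eq_bigr => v vu; rewrite mulrBl -addrA; congr (_ + _).
rewrite /k /coupling /mismatch /edge_prob /spin /=.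
by case: (s v); case: (incomm1 k1 u); case: (incomm1 k1 v) => /=; ring.
Qed.

Lemma Delta_field (G : graph N) s u : let k := incomm1 k1 u in
  Delta G alphan s u = (1 - 2 * mismatch s u) * 2 * (spin R k * deviation G s u +
   (eta * \sum_v coupling k v - drop k s - coupling k u * (1 - 2 * mismatch s u))).
Proof.
move=> k; rewrite /Delta (local_field G s u) -/k.
have -> : spin R (s u) = spin R k * (1 - 2 * mismatch s u).
  by rewrite /k /mismatch /spin; case: (s u); case: (incomm1 k1 u) => /=; ring.
have k2 : spin R k * spin R k = 1 by rewrite /spin; case: k; ring.
set F := (X in _ = _ * (_ + X)); set x := mismatch s u; set d := deviation G s u.
transitivity ((1 - 2 * x) * 2 * (spin R k * d + (spin R k * spin R k) * F)); last by rewrite k2 mul1r.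
by rewrite /F /x /d; ring.
Qed.

Lemma mismatch_flip s u v :
  mismatch (flip s u) v = if v == u then 1 - mismatch s u else mismatch s v.
Proof.
rewrite /mismatch /flip ffunE; have [->|//] := eqVneq v u.
by case: (s u); case: (incomm1 k1 u) => /=; ring.
Qed.

Lemma sum_mismatch_flip s u (c : 'I_N -> R) :
  \sum_v c v * mismatch (flip s u) v = \sum_v c v * mismatch s v + c u * (1 - 2 * mismatch s u).
Proof.
rewrite (bigD1 u)//= [X in _ = X + _](bigD1 u)//= mismatch_flip eqxx.
rewrite [X in _ + X = _](_ : _ = \sum_(v | v != u) c v * mismatch s v); first by ring.
by apply: eq_bigr => v /negbTE vu; rewrite mismatch_flip vu.
Qed.

Lemma drop_flip k s u :
  drop k (flip s u) = drop k s + 2 * coupling k u * (1 - 2 * mismatch s u).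
Proof.
have dropE t : drop k t = 2 * (\sum_v coupling k v * mismatch t v) - (1 - eta) * \sum_v coupling k v.
  by rewrite /drop !mulr_sumr -sumrB; apply: eq_bigr => v _; rewrite /excess; ring.
by rewrite !dropE sum_mismatch_flip; ring.
Qed.

End MeanField.

(** * Drift of the mismatch count and of the barrier *)

Section Lyapunov.
Variables (R : realType) (N k1 : nat) (pin pout alphan eta : R) (beta : \bar R).
Variables (G : graph N) (C H M : R).
Implicit Types (s : config N) (u v : 'I_N) (k : bool).

Local Notation x := (@mismatch R N k1).
Local Notation gam := (@coupling R N k1 pin pout alphan).
Local Notation y := (@drop R N k1 pin pout alphan eta).
Local Notation dev := (@deviation R N k1 pin pout G).
Local Notation q s u := (rate beta (Delta G alphan s u)).
Local Notation L := (kernel_op (generator G alphan beta)).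

Hypothesis beta_gt0 : (0 < beta)%E.
Hypothesis eta_gt0 : 0 < eta.
Hypothesis eta_le1 : eta <= 1.
Hypothesis H_gt0 : 0 < H.
Hypothesis coupling_sum : forall k, H <= \sum_v gam k v.
Hypothesis coupling_le : forall k v, `|gam k v| <= C.
Hypothesis C_ge0 : 0 <= C.
Hypothesis C_small : 4 * C <= eta * H.
Hypothesis M_ge0 : 0 <= M.
Hypothesis dev_le : forall s, \sum_u `|dev s u| <= M.

(** While the drops stay below [theta], a field of at least [eta * H / 2] remains; self-interaction
    costs at most [C <= eta * H / 4], leaving [2 * kappa]. A deviation of at most [kappa] leaves
    [kappa], and [Delta] carries a factor 2: hence the argument of [rho]. *)
Let theta : R := eta * H / 2.
Let kappa : R := eta * H / 8.
Let rho : R := rate beta (2 * kappa).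

(** Bound on the total discrepancy between flip rates and mismatches: [rho] per node, plus a
    Markov-type bound on the number of nodes whose deviation exceeds [kappa]. *)
Definition flip_error : R := N%:R * rho + M / kappa.

(** Squared positive parts give a continuously differentiable function of the drops, so flips have a
    first-order term and a quadratic remainder. The scaling makes it reach 1 once some drop reaches
    [theta]. *)
Definition barrier s : R := theta ^- 2 * \sum_(k : bool) Num.max 0 (y k s) ^+ 2.

(** Truncation at 1 makes the drift nonpositive wherever the fields may have the wrong sign. *)
Definition trunc_barrier s : R := Num.min 1 (barrier s).

Definition num_mismatch s : R := \sum_u x s u.

Let eH : 0 < eta * H. Proof. exact: mulr_gt0. Qed.
Let theta_gt0 : 0 < theta. Proof. by rewrite divr_gt0. Qed.
Let kappa_gt0 : 0 < kappa. Proof. by rewrite divr_gt0. Qed.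

Lemma barrier_ge0 s : 0 <= barrier s.
Proof.
rewrite mulr_ge0 ?invr_ge0 ?exprn_ge0 ?(ltW theta_gt0)//.
by apply: sumr_ge0 => k _; rewrite sqr_ge0.
Qed.

Lemma trunc_barrier_ge0 s : 0 <= trunc_barrier s.
Proof. by rewrite le_min ler01 barrier_ge0. Qed.

Lemma trunc_barrier_le1 s : trunc_barrier s <= 1.
Proof. by rewrite ge_min lexx. Qed.

Lemma flip_error_ge0 : 0 <= flip_error.
Proof.
by rewrite addr_ge0 ?divr_ge0 ?mulr_ge0 ?rate_ge0// ltW.
Qed.

Lemma barrier_lt1 k s : barrier s < 1 -> y k s < theta.
Proof.
move=> b1; rewrite ltNge; apply/negP => h.
suff : 1 <= barrier s by rewrite leNgt b1.
rewrite /barrier mulrC ler_pdivlMr ?exprn_gt0// mul1r (bigD1 k)//=.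
apply: ler_wpDr; first by apply: sumr_ge0 => ? _; rewrite sqr_ge0.
rewrite lerXn2r ?nnegrE ?(ltW theta_gt0) ?le_max ?lexx//.
by rewrite h orbT.
Qed.

(* If [|dev| > kappa] the last term exceeds 1 and the bound is trivial. *)
Lemma rate_mismatch s u : barrier s < 1 ->
  `|q s u - x s u| <= rho + `|dev s u| / kappa.
Proof.
move=> b1.
have q01 : 0 <= q s u <= 1 by rewrite rate_ge0 rate_le1.
have rho0 : 0 <= rho by exact: rate_ge0.
have [dk|dk] := leP (`|dev s u|) kappa; last first.
  have h1 : 1 <= `|dev s u| / kappa by rewrite ler_pdivlMr// mul1r ltW.
  by rewrite ler_norml; case: (mismatch01 R k1 s u) => ->; lra.
have h0 : 0 <= `|dev s u| / kappa by rewrite divr_ge0// ltW.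
suff : `|q s u - x s u| <= rho by lra.
move: (@Delta_field R N k1 pin pout alphan eta G s u) => /=; set k := incomm1 k1 u.
set sd := spin R k * _; set g := eta * _ - _ - _ => D.
have g2 : 2 * kappa <= g.
  have := barrier_lt1 k b1; have := ler_wpM2l (ltW eta_gt0) (coupling_sum k).
  have : gam k u * (1 - 2 * x s u) <= C.
    apply: le_trans (coupling_le k u); case: (mismatch01 R k1 s u) => ->.
      by rewrite mulr0 subr0 mulr1 ler_norm.
    by rewrite mulr1 (_ : 1 - 2 = -1); [rewrite mulrN1 -normrN ler_norm|ring].
  by rewrite /theta /kappa /g; move: C_small; lra.
have sdk : - kappa <= sd.
  have : `|sd| <= kappa.
    by rewrite normrM (_ : `|spin R k| = 1) ?mul1r// /spin; case: k {D g2 sd g}; rewrite ?normrN normr1.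
  by rewrite ler_norml => /andP[].
have pos : 2 * kappa <= 2 * (sd + g) by lra.
have r := rate_nincr beta_gt0 pos.
have r0 := rate_ge0 beta (2 * (sd + g)).
rewrite -/rho in r; rewrite {}D.
case: (mismatch01 R k1 s u) => ->.
  by rewrite mulr0 !subr0 mul1r ger0_norm// rate_ge0.
(* For a mismatched node [Delta] changes sign, and by [rateN] its rate is within [rho] of 1. *)
rewrite mulr1 (_ : (1 - 2) * 2 * (sd + g) = - (2 * (sd + g))); last by ring.
by rewrite rateN// addrAC subrr add0r normrN ger0_norm.
Qed.

Lemma sum_rate_mismatch s : barrier s < 1 ->
  \sum_u `|q s u - x s u| <= flip_error.
Proof.
move=> b1; apply: (@le_trans _ _ (\sum_u (rho + `|dev s u| / kappa))).
  by apply: ler_sum => u _; exact: rate_mismatch.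
rewrite big_split /= sumr_const card_ord /flip_error mulr_natl lerD2l -mulr_suml.
by apply: ler_wpM2r; [rewrite invr_ge0 ltW|exact: dev_le].
Qed.

(** Flipping [u] changes the count by [1 - 2 * x s u]; with rates exactly [x s u] the drift would be
    minus the count, as [x * (1 - 2 * x) = - x]. Where the barrier is at least 1, the term
    [N%:R * trunc_barrier s] is [N] and covers the trivial bound. *)
Lemma num_mismatch_drift s :
  L num_mismatch s <= - num_mismatch s + flip_error + N%:R * trunc_barrier s.
Proof.
rewrite generator_op.
have fl u : num_mismatch (flip s u) - num_mismatch s = 1 - 2 * x s u.
  have e t : num_mismatch t = \sum_v 1 * x t v by apply: eq_bigr => v _; rewrite mul1r.
  by rewrite !e (sum_mismatch_flip k1 s u (fun=> 1)); ring.
under eq_bigr do rewrite fl.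
have [b1|b1] := ltP (barrier s) 1.
  apply: (@le_trans _ _ (- num_mismatch s + flip_error)); last first.
    by rewrite lerDl mulr_ge0// trunc_barrier_ge0.
  apply: le_trans (lerD (lexx (- num_mismatch s)) (sum_rate_mismatch b1)).
  rewrite /num_mismatch -sumrN -big_split; apply: ler_sum => u _ /=.
  have := ler_norm (q s u - x s u); have := ler_norm (- (q s u - x s u)).
  rewrite normrN; case: (mismatch01 R k1 s u) => ->; lra.
have -> : trunc_barrier s = 1 by apply/min_idPl.
have := flip_error_ge0.
suff : \sum_u q s u * (1 - 2 * x s u) <= - num_mismatch s + N%:R by lra.
have -> : N%:R = \sum_(u < N) 1 :> R by rewrite sumr_const card_ord.
rewrite /num_mismatch -sumrN -big_split; apply: ler_sum => u _ /=.
have := rate_ge0 beta (Delta G alphan s u); have := rate_le1 beta_gt0 (Delta G alphan s u).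
case: (mismatch01 R k1 s u) => ->; lra.
Qed.

(** The right side completes to [(max 0 a + d) ^ 2], which dominates because
    [a + d <= max 0 a + d]. *)
Lemma maxr0_sqrD (a d : R) :
  Num.max 0 (a + d) ^+ 2 - Num.max 0 a ^+ 2 <= 2 * Num.max 0 a * d + d ^+ 2.
Proof.
rewrite lerBlDr [X in _ <= X](_ : _ = (Num.max 0 a + d) ^+ 2); last by ring.
have [_|h] := leP (a + d) 0; first by rewrite expr0n sqr_ge0.
have am : a <= Num.max 0 a by rewrite le_max lexx orbT.
by rewrite lerXn2r ?nnegrE ?lerD2r ?(ltW h)// (le_trans (ltW h))// lerD2r.
Qed.

Lemma drop_le k s : y k s <= 2 * C * N%:R.
Proof.
rewrite mulr_natr.
have -> : (2 * C) *+ N = \sum_(u < N) 2 * C by rewrite sumr_const card_ord.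
apply: ler_sum => v _; apply: (le_trans (ler_norm _)); rewrite normrM mulrC.
apply: ler_pM => //; rewrite /excess.
by case: (mismatch01 R k1 s v) => ->; rewrite ler_norml; apply/andP; split; move: eta_gt0 eta_le1; lra.
Qed.

(** With mismatches in place of rates, the first-order term is at most [2 * p * (- y k s) <= 0]: the
    mean-field dynamics is restoring. There remain the rate discrepancy, weighted by
    [p <= 2 * C * N], and the quadratic term. *)
Lemma drop_drift k s : barrier s < 1 ->
  \sum_u q s u * (Num.max 0 (y k (flip s u)) ^+ 2 - Num.max 0 (y k s) ^+ 2)
  <= C ^+ 2 * N%:R * (8 * flip_error + 4).
Proof.
move=> b1; pose p := Num.max 0 (y k s).
have p0 : 0 <= p by rewrite le_max lexx.
have pN : p <= 2 * C * N%:R.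
  by rewrite ge_max drop_le andbT !mulr_ge0.
pose d u : R := 2 * gam k u * (1 - 2 * x s u).
have dC u : `|d u| <= 2 * C.
  rewrite /d -mulrA normrM ger0_norm// ler_pM2l// normrM.
  apply: le_trans (coupling_le k u); rewrite -[X in _ <= X]mulr1; apply: ler_wpM2l => //.
  by case: (mismatch01 R k1 s u) => ->; rewrite ler_norml; apply/andP; split; lra.
have C2 := ler_wpM2l (mulr_ge0 (ler0n R 2) C_ge0).
apply: (@le_trans _ _ (\sum_u q s u * (2 * p * d u + d u ^+ 2))).
  by apply: ler_sum => u _; rewrite ler_wpM2l ?rate_ge0// drop_flip maxr0_sqrD.
have -> : \sum_u q s u * (2 * p * d u + d u ^+ 2) =
    2 * p * (\sum_u x s u * d u + \sum_u (q s u - x s u) * d u) + \sum_u q s u * d u ^+ 2.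
  by rewrite -big_split mulr_sumr -big_split; apply: eq_bigr => u _ /=; ring.
have h1 : \sum_u q s u * d u ^+ 2 <= 4 * C ^+ 2 * N%:R.
  rewrite mulr_natr.
  have -> : (4 * C ^+ 2) *+ N = \sum_(u < N) 4 * C ^+ 2 by rewrite sumr_const card_ord.
  apply: ler_sum => u _; rewrite -[X in _ <= X]mul1r.
  apply: ler_pM; rewrite ?rate_ge0 ?sqr_ge0 ?rate_le1//.
  rewrite -real_normK ?num_real// (_ : 4 * C ^+ 2 = (2 * C) ^+ 2); last by ring.
  by rewrite lerXn2r ?nnegrE// mulr_ge0.
have h2 : \sum_u (q s u - x s u) * d u <= 2 * C * flip_error.
  apply: (@le_trans _ _ (\sum_u 2 * C * `|q s u - x s u|)).
    apply: ler_sum => u _; apply: (le_trans (ler_norm _)).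
    by rewrite normrM mulrC ler_wpM2r.
  by rewrite -mulr_sumr; apply: ler_wpM2l; [rewrite mulr_ge0|exact: sum_rate_mismatch].
(* Again [x * (1 - 2 * x) = - x]; centring [excess] leaves [(1 - eta)] times the total coupling,
   which has a favourable sign. *)
have h3 : \sum_u x s u * d u <= - y k s.
  have -> : \sum_u x s u * d u = - (y k s) - (1 - eta) * \sum_v gam k v.
    rewrite /drop mulr_sumr -sumrN -sumrB; apply: eq_bigr => u _; rewrite /d /excess.
    by case: (mismatch01 R k1 s u) => ->; ring.
  rewrite gerBl mulr_ge0 ?subr_ge0//.
  by apply: le_trans (coupling_sum k); exact: ltW.
have h4 : p * (- y k s) <= 0.
  by rewrite /p; case: (leP 0 (y k s)) => h; rewrite ?mul0r// mulrN oppr_le0 mulr_ge0.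
have h5 : p * (\sum_u x s u * d u + \sum_u (q s u - x s u) * d u) <= 2 * C * N%:R * (2 * C * flip_error).
  rewrite mulrDr.
  have e1 := ler_wpM2l p0 h3; have e2 := ler_wpM2l p0 h2.
  have e3 : p * (2 * C * flip_error) <= 2 * C * N%:R * (2 * C * flip_error).
    by apply: ler_wpM2r => //; rewrite !mulr_ge0// flip_error_ge0.
  lra.
have -> : C ^+ 2 * N%:R * (8 * flip_error + 4) =
  2 * (2 * C * N%:R * (2 * C * flip_error)) + 4 * C ^+ 2 * N%:R by ring.
by rewrite -mulrA; lra.
Qed.

(* Twice the bound of [drop_drift] divided by [theta ^ 2], one term per community. *)
Definition barrier_rate : R := (C / theta) ^+ 2 * N%:R * (16 * flip_error + 8).

Lemma barrier_rate_ge0 : 0 <= barrier_rate.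
Proof.
apply: mulr_ge0; first by rewrite mulr_ge0 ?sqr_ge0.
by rewrite addr_ge0// mulr_ge0// flip_error_ge0.
Qed.

(** Where the barrier is at least 1 the truncated function is maximal and cannot increase. Elsewhere
    it equals [barrier] at [s] and is at most [barrier] after a flip. *)
Lemma trunc_barrier_drift s : L trunc_barrier s <= barrier_rate.
Proof.
have rate0 := barrier_rate_ge0.
rewrite generator_op.
have [b1|b1] := ltP (barrier s) 1; last first.
  apply: le_trans rate0; apply: sumr_le0 => u _.
  have -> : trunc_barrier s = 1 by apply/min_idPl.
  by rewrite mulr_ge0_le0 ?rate_ge0// subr_le0 trunc_barrier_le1.
have -> : trunc_barrier s = barrier s by apply/min_idPr; exact: ltW.
apply: (@le_trans _ _ (\sum_u q s u * (barrier (flip s u) - barrier s))).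
  apply: ler_sum => u _; rewrite ler_wpM2l ?rate_ge0// lerD2r.
  by rewrite ge_min lexx orbT.
have -> : \sum_u q s u * (barrier (flip s u) - barrier s) = theta ^- 2 *
   \sum_(k : bool) \sum_u q s u * (Num.max 0 (y k (flip s u)) ^+ 2 - Num.max 0 (y k s) ^+ 2).
  rewrite exchange_big mulr_sumr; apply: eq_bigr => u _.
  by rewrite /barrier -mulrBr -sumrB -mulr_sumr mulrCA.
have -> : barrier_rate = theta ^- 2 * \sum_(k : bool) C ^+ 2 * N%:R * (8 * flip_error + 4).
  rewrite sumr_const card_bool /barrier_rate expr_div_n.
  set t2 := (theta ^+ 2)^-1; ring.
apply: ler_wpM2l; first by rewrite invr_ge0 sqr_ge0.
by apply: ler_sum => k _; exact: drop_drift.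
Qed.

Lemma num_mismatch_ge0 s : 0 <= num_mismatch s.
Proof. by apply: sumr_ge0 => u _; rewrite /mismatch. Qed.

Lemma num_mismatch_le s : num_mismatch s <= N%:R.
Proof.
have -> : N%:R = \sum_(u < N) 1 :> R by rewrite sumr_const card_ord.
by apply: ler_sum => u _; rewrite /mismatch lern1 leq_b1.
Qed.

(** [semigroup_bound] with [psi] equal to [N] times the truncated barrier: its drift bound turns the
    chance of leaving the good region into a term linear in [tau]. *)
Lemma good_graph_bound (tau : R) s : 0 <= tau ->
  \sum_r transition G alphan beta tau s r * num_mismatch r <=
  expR (- tau) * N%:R + flip_error + N%:R * barrier s + N%:R * barrier_rate * tau.
Proof.
move=> tau0.
have B0 := generator_unif_ge0 G alphan beta_gt0.
have Q0 := generator_row0 G alphan beta.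
have L1 : 1 <= N.+1%:R :> R by rewrite ler1n.
have rate0 := barrier_rate_ge0.
apply: (@le_trans _ _ (expR (- tau) * num_mismatch s + flip_error +
    N%:R * trunc_barrier s + N%:R * barrier_rate * tau)).
  apply: (@semigroup_bound _ _ _ _ B0 Q0 L1 num_mismatch (fun s => N%:R * trunc_barrier s)) => //.
  - exact: num_mismatch_ge0.
  - by move=> r; rewrite mulr_ge0// trunc_barrier_ge0.
  - exact: flip_error_ge0.
  - exact: mulr_ge0.
  - exact: num_mismatch_drift.
  move=> r; rewrite /kernel_op; under eq_bigr do rewrite mulrCA.
  by rewrite -mulr_sumr ler_wpM2l//; exact: trunc_barrier_drift.
rewrite lerD2r; apply: lerD; first rewrite lerD2r.
  by rewrite ler_wpM2l ?expR_ge0// num_mismatch_le.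
by rewrite ler_wpM2l// ge_min lexx orbT.
Qed.

End Lyapunov.

(** * Exponential moment of a centred Bernoulli variable *)

Section ExpMoment.
Variable R : realType.

(** From [exp x * (1 - x) <= 1], since the quadratic times [1 - x] is
    [1 + x ^ 2 * (1 - 2 * x) >= 1]. *)
Lemma expR_le_quadratic (x : R) : x <= 2^-1 -> expR x <= 1 + x + 2 * x ^+ 2.
Proof.
move=> x2.
have h : expR x * (1 - x) <= 1.
  by rewrite -[X in _ <= X](expRxMexpNx_1 x) ler_wpM2l ?expR_ge0// expR_ge1Dx.
have x1 : 0 < 1 - x by lra.
rewrite -(ler_pM2r x1); apply: (le_trans h).
have : 0 <= x ^+ 2 * (1 - 2 * x) by rewrite mulr_ge0 ?sqr_ge0//; lra.
have -> : (1 + x + 2 * x ^+ 2) * (1 - x) = 1 + x ^+ 2 * (1 - 2 * x) by ring.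
lra.
Qed.

(** The linear terms cancel by centring, and the variance [p * (1 - p)] is at most [p]. *)
Lemma bernoulli_exp_moment (p z : R) : 0 <= p <= 1 -> `|z| <= 2^-1 ->
  p * expR (z * (1 - p)) + (1 - p) * expR (z * (0 - p)) <= expR (2 * z ^+ 2 * p).
Proof.
move=> /andP[p0 p1] z2.
have p1' : 0 <= 1 - p by rewrite subr_ge0.
have hz (c : R) : `|c| <= 1 -> z * c <= 2^-1.
  move=> c1; apply: (le_trans (ler_norm _)); rewrite normrM -[X in _ <= X]mulr1.
  exact: ler_pM.
have h1 := ler_wpM2l p0 (expR_le_quadratic (hz (1 - p) _)).
have h2 := ler_wpM2l p1' (expR_le_quadratic (hz (0 - p) _)).
apply: le_trans (expR_ge1Dx _).
have {}h1 := h1 (ltac:(rewrite ger0_norm//; lra)).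
have {}h2 := h2 (ltac:(rewrite sub0r normrN ger0_norm//)).
apply: (le_trans (lerD h1 h2)).
have : 0 <= 2 * z ^+ 2 * p * p by do 3!apply: mulr_ge0 => //; exact: sqr_ge0.
rewrite -subr_ge0 => h; rewrite -subr_ge0; move: h; rewrite subr0.
by congr (0 <= _); ring.
Qed.

End ExpMoment.

(** * Uniform control of the edge fluctuations *)

Section GraphDeviation.
Variables (R : realType) (N k1 : nat) (pin pout P : R).
Hypothesis pin01 : 0 <= pin <= P.
Hypothesis pout01 : 0 <= pout <= P.
Hypothesis P_le1 : P <= 1.
Implicit Types (G : graph N) (s t : config N).

Local Notation ep := (@edge_prob R N k1 pin pout).
Local Notation dev G := (@deviation R N k1 pin pout G).

Lemma edge_prob_bounds p : 0 <= ep p <= P.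
Proof. by rewrite /edge_prob; case: ifP. Qed.

Let ep01 p : 0 <= ep p <= 1.
Proof. by have /andP[-> /le_trans ->] := edge_prob_bounds p. Qed.

(** Pairs not in increasing order carry a point mass at [false], which makes the graph law a product
    measure over all pairs. *)
Let factor (p : 'I_N * 'I_N) (b : bool) : R :=
  if (p.1 < p.2)%N then (if b then ep p else 1 - ep p) else (~~ b)%:R.

Lemma graph_law_prod G : graph_law k1 pin pout G = \prod_p factor p (G p).
Proof.
rewrite /graph_law [RHS](bigID (fun p : 'I_N * 'I_N => (p.1 < p.2)%N)) /=; congr (_ * _).
  by apply: eq_bigr => p lp; rewrite /factor lp.
case: ifP => [/forallP h|/negbT].
  rewrite big1// => p lp; rewrite /factor (negbTE lp).
  by have := h p; rewrite lp /= => ->.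
rewrite negb_forall => /existsP[p]; rewrite negb_imply negbK => /andP[lp Gp].
by rewrite (bigD1 p)//= /factor (negbTE lp) Gp mul0r.
Qed.

Lemma graph_law_ge0 G : 0 <= graph_law k1 pin pout G.
Proof.
rewrite graph_law_prod; apply: prodr_ge0 => p _; rewrite /factor.
have /andP[h1 h2] := ep01 p.
by case: ifP => // _; case: (G p) => //; rewrite subr_ge0.
Qed.

Lemma graph_law_expect (h : 'I_N * 'I_N -> bool -> R) :
  \sum_(G : graph N) graph_law k1 pin pout G * \prod_(p : 'I_N * 'I_N | (p.1 < p.2)%N) h p (G p) =
  \prod_(p : 'I_N * 'I_N | (p.1 < p.2)%N) (ep p * h p true + (1 - ep p) * h p false).
Proof.
pose h' (p : 'I_N * 'I_N) b := if (p.1 < p.2)%N then h p b else 1.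
have -> : \prod_(p : 'I_N * 'I_N | (p.1 < p.2)%N) (ep p * h p true + (1 - ep p) * h p false) =
    \prod_p \sum_b factor p b * h' p b.
  rewrite big_mkcond; apply: eq_bigr => p _; rewrite big_bool /factor /h'.
  by case: ifP => _ //=; rewrite mul0r mulr1 add0r.
rewrite bigA_distr_bigA; apply: eq_bigr => G _ /=.
by rewrite graph_law_prod big_split /= [X in _ * X = _]big_mkcond.
Qed.

Lemma graph_law_sum1 : \sum_(G : graph N) graph_law k1 pin pout G = 1.
Proof.
have := graph_law_expect (fun _ _ => 1).
under eq_bigr do rewrite big1// mulr1; move=> ->.
by rewrite big1// => p _; ring.
Qed.

Let weight s t (p : 'I_N * 'I_N) : R :=
  spin R (t p.1) * spin R (s p.2) + spin R (t p.2) * spin R (s p.1).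

(* The sum of [|dev_u|] is this sum for the signs [t] of the deviations; grouping
   [(u, v)] with [(v, u)] makes it a sum of independent terms. *)
Lemma deviation_sum G s t :
  \sum_u spin R (t u) * dev G s u =
  \sum_(p : 'I_N * 'I_N | (p.1 < p.2)%N) weight s t p * ((G p)%:R - ep p).
Proof.
pose f (p : 'I_N * 'I_N) : R :=
  spin R (t p.1) * (((adj G p.1 p.2)%:R - ep p) * spin R (s p.2)).
have -> : \sum_u spin R (t u) * dev G s u = \sum_(p : 'I_N * 'I_N | p.2 != p.1) f p.
  rewrite (eq_bigl (fun p : 'I_N * 'I_N => xpredT p.1 && (p.2 != p.1)))//.
  rewrite -(pair_big_dep xpredT (fun u v => v != u) (fun u v => f (u, v))) /=.
  by apply: eq_bigr => u _; rewrite mulr_sumr.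
rewrite (bigID (fun p : 'I_N * 'I_N => (p.1 < p.2)%N)) /=.
rewrite (eq_bigl (fun p : 'I_N * 'I_N => (p.1 < p.2)%N)); last first.
  move=> p /=; rewrite -val_eqE /= eq_sym neq_ltn.
  by case: (ltngtP p.1 p.2).
rewrite [X in _ + X](eq_bigl (fun p : 'I_N * 'I_N => (p.2 < p.1)%N)); last first.
  move=> p /=; rewrite -val_eqE /= eq_sym neq_ltn.
  by case: (ltngtP p.1 p.2).
rewrite [X in _ + X](reindex_inj (h := fun p : 'I_N * 'I_N => (p.2, p.1))) /=; last first.
  by move=> [a b] [c d] [-> ->].
rewrite -big_split; apply: eq_bigr => -[u v] /= uv.
rewrite /f /weight /adj /= uv ltnNge (ltnW uv) /= /edge_prob /= [incomm1 k1 v == _]eq_sym.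
by ring.
Qed.

(** The weights are at most 2, so [th <= 1/4] permits [bernoulli_exp_moment]; each independent term
    contributes at most [exp(2 * (2 * th) ^ 2 * P)], and there are at most [N ^ 2] of them. *)
Lemma deviation_exp_moment (th : R) s t : 0 <= th <= 4^-1 ->
  \sum_(G : graph N) graph_law k1 pin pout G * expR (th * \sum_u spin R (t u) * dev G s u)
  <= expR (8 * th ^+ 2 * P * N%:R ^+ 2).
Proof.
move=> /andP[th0 th4].
have P0 : 0 <= P by have /andP[] := pin01; exact: le_trans.
have spin1 b : `|spin R b| = 1 by rewrite /spin; case: b; rewrite ?normrN normr1.
have wle p : `|weight s t p| <= 2.
  apply: (le_trans (ler_normD _ _)); rewrite !normrM !spin1; lra.
under eq_bigr do rewrite deviation_sum mulr_sumr expR_sum.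
rewrite (graph_law_expect (fun p b => expR (th * (weight s t p * (b%:R - ep p))))).
apply: (@le_trans _ _ (\prod_(p : 'I_N * 'I_N) expR (8 * th ^+ 2 * P))); last first.
  rewrite prodr_const card_prod card_ord -expRM_natr natrM.
  by rewrite ler_expR -expr2.
have c0 : 0 <= 8 * th ^+ 2 * P by do 2!apply: mulr_ge0 => //; exact: sqr_ge0.
rewrite big_mkcond; apply: ler_prod => p _; case: ifP => _; last first.
  by rewrite ler01 -[X in X <= _](expR0 R) ler_expR.
have /andP[e0 eP] := edge_prob_bounds p; have /andP[_ e1] := ep01 p.
have e1' : 0 <= 1 - ep p by rewrite subr_ge0.
apply/andP; split; first by rewrite addr_ge0// mulr_ge0// expR_ge0.
rewrite ![th * (_ * (_ - _))]mulrA.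
have z2 : `|th * weight s t p| <= 2 * th.
  by rewrite normrM ger0_norm// mulrC ler_wpM2r.
apply: (le_trans (bernoulli_exp_moment (ep01 p) _)); first by apply: le_trans z2 _; lra.
rewrite ler_expR; apply: ler_pM => //; first by rewrite mulr_ge0// sqr_ge0.
rewrite -[(th * weight s t p) ^+ 2]real_normK ?num_real// (_ : 8 * th ^+ 2 = 2 * (2 * th) ^+ 2); last by ring.
by rewrite ler_pM2l// lerXn2r ?nnegrE// mulr_ge0.
Qed.

Definition good_graph (M : R) G : bool :=
  [forall s : config N, \sum_u `|dev G s u| <= M].

(** Exponential Markov inequality and a union bound over the [2 ^ N] configurations and the [2 ^ N]
    sign patterns of the deviations. *)
Lemma bad_graph_prob (th M : R) : 0 <= th <= 4^-1 ->
  \sum_(G : graph N) graph_law k1 pin pout G * (~~ good_graph M G)%:R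
  <= 4 ^+ N * expR (8 * th ^+ 2 * P * N%:R ^+ 2 - th * M).
Proof.
move=> th04; have /andP[th0 _] := th04.
pose X G s t : R := \sum_u spin R (t u) * dev G s u.
apply: (@le_trans _ _ (\sum_(G : graph N) graph_law k1 pin pout G *
   \sum_(s : config N) \sum_(t : config N) expR (th * X G s t) * expR (- (th * M)))).
  apply: ler_sum => G _; rewrite ler_wpM2l ?graph_law_ge0//.
  have p0 s : 0 <= \sum_(t : config N) expR (th * X G s t) * expR (- (th * M)).
    by apply: sumr_ge0 => t _; rewrite mulr_ge0 ?expR_ge0.
  case: (boolP (good_graph M G)) => [_|]; first exact: sumr_ge0.
  rewrite negb_forall => /existsP[s]; rewrite -ltNge => lt.
  (* With these signs the linear form [X G s t] is the sum of the absolute deviations. *)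
  pose t : config N := [ffun u => 0 <= dev G s u].
  rewrite (bigD1 s)//= ler_wpDr ?sumr_ge0//.
  rewrite (bigD1 t)//=; apply: ler_wpDr.
    by apply: sumr_ge0 => r _; rewrite mulr_ge0 ?expR_ge0.
  rewrite -expRD -[X in X <= _](expR0 R) ler_expR subr_ge0 ler_wpM2l// (le_trans (ltW lt))//.
  apply: ler_sum => u _; rewrite /t ffunE /spin.
  have [h|h] := leP 0 (dev G s u); first by rewrite mul1r ger0_norm.
  by rewrite mulN1r ltr0_norm.
have -> : 4 ^+ N * expR (8 * th ^+ 2 * P * N%:R ^+ 2 - th * M) = \sum_(s : config N)
   \sum_(t : config N) expR (8 * th ^+ 2 * P * N%:R ^+ 2) * expR (- (th * M)).
  rewrite !sumr_const !card_ffun !card_bool card_ord -mulrnA -expnMn -expRD.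
  by rewrite -[RHS]mulr_natl natrX.
under eq_bigr do rewrite mulr_sumr.
rewrite exchange_big; apply: ler_sum => s _.
under eq_bigr do rewrite mulr_sumr.
rewrite exchange_big; apply: ler_sum => t _.
under eq_bigr do rewrite mulrA; rewrite -mulr_suml ler_wpM2r ?expR_ge0//.
exact: deviation_exp_moment.
Qed.

End GraphDeviation.

(** * Variance of the fields under the initial law *)

Section InitialLaw.
Variables (R : realType) (N k1 : nat) (eta : R).
Hypothesis eta_gt0 : 0 < eta.
Hypothesis eta_le1 : eta <= 1.
Implicit Types (s : config N) (u v : 'I_N).

Let factor u (b : bool) : R :=
  if b == incomm1 k1 u then eta + (1 - eta) / 2 else (1 - eta) / 2.

Local Notation law := (@init_law R N k1 eta).
Local Notation xi := (@excess R N k1 eta).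

Lemma init_law_ge0 s : 0 <= law s.
Proof.
apply: prodr_ge0 => u _; move: eta_gt0 eta_le1.
by case: ifP => _ ? ?; lra.
Qed.

Lemma init_law_expect (h : 'I_N -> bool -> R) :
  \sum_(s : config N) law s * \prod_u h u (s u) = \prod_u \sum_b factor u b * h u b.
Proof.
by rewrite bigA_distr_bigA; apply: eq_bigr => s _; rewrite big_split.
Qed.

Lemma init_law_sum1 : \sum_(s : config N) law s = 1.
Proof.
transitivity (\sum_(s : config N) law s * \prod_(u < N) 1).
  by apply: eq_bigr => s _; rewrite big1// mulr1.
rewrite (init_law_expect (fun _ _ => 1)).
by rewrite big1// => u _; rewrite big_bool /factor; case: incomm1 => /=; lra.
Qed.

Lemma excess_uncorrelated u v : u != v ->
  \sum_(s : config N) law s * (xi s u * xi s v) = 0.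
Proof.
move=> uv.
pose h w (b : bool) : R :=
  if (w == u) || (w == v) then 2 * (b != incomm1 k1 w)%:R - (1 - eta) else 1.
have e s : xi s u * xi s v = \prod_w h w (s w).
  rewrite (bigD1 u)//= (bigD1 v) ?[v == u]eq_sym//= big1 => [|w /andP[wu wv]].
    by rewrite mulr1 /h !eqxx orbT.
  by rewrite /h (negbTE wu) (negbTE wv).
under eq_bigr do rewrite e.
rewrite init_law_expect (bigD1 u)//= big_bool /factor /h eqxx /=.
by case: incomm1 => /=; field.
Qed.

(** Off-diagonal covariances vanish by [excess_uncorrelated], and [|excess| <= 2] bounds each
    diagonal term. *)
Lemma excess_sum_variance (c : 'I_N -> R) (C : R) : (forall v, `|c v| <= C) ->
  \sum_(s : config N) law s * (\sum_v c v * xi s v) ^+ 2 <= 4 * C ^+ 2 * N%:R.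
Proof.
move=> cC.
have -> : \sum_(s : config N) law s * (\sum_v c v * xi s v) ^+ 2 =
    \sum_u \sum_v c u * c v * \sum_(s : config N) law s * (xi s u * xi s v).
  transitivity (\sum_(s : config N) \sum_u \sum_v law s * (c u * xi s u * (c v * xi s v))).
    apply: eq_bigr => s _; rewrite expr2 mulr_suml mulr_sumr; apply: eq_bigr => u _.
    by rewrite mulr_sumr mulr_sumr.
  rewrite exchange_big; apply: eq_bigr => u _ /=.
  rewrite exchange_big; apply: eq_bigr => v _ /=.
  by rewrite mulr_sumr; apply: eq_bigr => s _; ring.
rewrite mulr_natr.
have -> : (4 * C ^+ 2) *+ N = \sum_(u < N) 4 * C ^+ 2 by rewrite sumr_const card_ord.
apply: ler_sum => u _; rewrite (bigD1 u)//= [X in _ + X]big1 ?addr0; last first.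
  by move=> v vu; rewrite excess_uncorrelated ?mulr0// eq_sym.
rewrite mulrC; apply: ler_pM.
- by apply: sumr_ge0 => s _; rewrite mulr_ge0 ?init_law_ge0// -expr2 sqr_ge0.
- by rewrite -expr2 sqr_ge0.
- rewrite -[X in _ <= X]mul1r -[X in _ <= X * _]init_law_sum1 mulr_suml; apply: ler_sum => s _.
  apply: ler_wpM2l; first exact: init_law_ge0.
  have h : `|xi s u| <= 2.
    rewrite /excess; case: (mismatch01 R k1 s u) => ->;
      by rewrite ler_norml; apply/andP; split; move: eta_gt0 eta_le1; lra.
  rewrite -expr2 -real_normK ?num_real// (_ : 4 = 2 ^+ 2); last by ring.
  by rewrite lerXn2r ?nnegrE.
- rewrite -expr2 -real_normK ?num_real//.
  by rewrite lerXn2r ?nnegrE// (le_trans _ (cC u)).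
Qed.

Lemma initial_barrier (pin pout alphan C H : R) : 0 < H ->
  (forall k v, `|@coupling R N k1 pin pout alphan k v| <= C) ->
  \sum_(s : config N) law s * barrier k1 pin pout alphan eta H s
  <= 8 * (C / (eta * H / 2)) ^+ 2 * N%:R.
Proof.
move=> H0 cC; rewrite /barrier; set th := eta * H / 2.
under eq_bigr do rewrite mulrCA mulr_sumr.
rewrite -mulr_sumr exchange_big /=.
have -> : 8 * (C / th) ^+ 2 * N%:R = th ^- 2 * \sum_(k : bool) 4 * C ^+ 2 * N%:R.
  by rewrite sumr_const card_bool expr_div_n; set t2 := (th ^+ 2)^-1; ring.
apply: ler_wpM2l; first by rewrite invr_ge0 sqr_ge0.
apply: ler_sum => k _; apply: le_trans (excess_sum_variance (cC k)).
apply: ler_sum => s _; apply: ler_wpM2l; first exact: init_law_ge0.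
rewrite -/(drop _ _ _ _ _ _ _); set y := drop _ _ _ _ _ _ _.
by case: (leP 0 y) => // _; rewrite expr0n sqr_ge0.
Qed.

End InitialLaw.

(** * Magnetization errors in terms of mismatches *)

Section Magnetization.
Variables (R : realType) (N k1 : nat).
Hypothesis k1_gt0 : (0 < k1)%N.
Hypothesis k1_ltN : (k1 < N)%N.
Implicit Types s : config N.

Lemma card_incomm1 : \sum_(u < N | incomm1 k1 u) 1 = k1%:R :> R.
Proof.
by rewrite -(big_ord_widen N (fun=> 1 : R) (ltnW k1_ltN)) sumr_const card_ord.
Qed.

Lemma card_incomm2 : \sum_(u < N | ~~ incomm1 k1 u) 1 = (N - k1)%:R :> R.
Proof.
rewrite natrB ?(ltnW k1_ltN)// -card_incomm1.
have -> : N%:R = \sum_(u < N) 1 :> R by rewrite sumr_const card_ord.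
by rewrite [X in X - _](bigID (fun u : 'I_N => incomm1 k1 u)) /= addrAC subrr add0r.
Qed.

(** Each magnetization error is exactly 2 over the community size times the number of mismatches
    there; the maximum is bounded by the sum. *)
Lemma err_le_mismatch s :
  err R k1 s <= (2 / k1%:R + 2 / (N - k1)%:R) * num_mismatch R k1 s.
Proof.
have k10 : 0 < k1%:R :> R by rewrite ltr0n.
have k20 : 0 < (N - k1)%:R :> R by rewrite ltr0n subn_gt0.
have x0 (u : 'I_N) : 0 <= mismatch R k1 s u by rewrite /mismatch.
pose S1 := \sum_(u < N | incomm1 k1 u) mismatch R k1 s u.
pose S2 := \sum_(u < N | ~~ incomm1 k1 u) mismatch R k1 s u.
have S10 : 0 <= S1 by apply: sumr_ge0.
have S20 : 0 <= S2 by apply: sumr_ge0.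
have -> : num_mismatch R k1 s = S1 + S2.
  by rewrite /num_mismatch (bigID (fun u : 'I_N => incomm1 k1 u)).
have e1 : magn1 R k1 s - 1 = - (2 / k1%:R * S1).
  rewrite /magn1 (eq_bigr (fun u => 1 - 2 * mismatch R k1 s u)); last first.
    by move=> u h; rewrite /mismatch h /spin; case: (s u) => /=; ring.
  rewrite sumrB card_incomm1 -mulr_sumr -/S1; field; exact: lt0r_neq0.
have e2 : magn2 R k1 s + 1 = 2 / (N - k1)%:R * S2.
  rewrite /magn2 (eq_bigr (fun u => 2 * mismatch R k1 s u - 1)); last first.
    by move=> u /negbTE h; rewrite /mismatch h /spin; case: (s u) => /=; ring.
  rewrite sumrB card_incomm2 -mulr_sumr -/S2; field; exact: lt0r_neq0.
have a1 : 0 <= 2 / k1%:R :> R by rewrite divr_ge0.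
have a2 : 0 <= 2 / (N - k1)%:R :> R by rewrite divr_ge0.
rewrite /err e1 e2 normrN !ger0_norm ?mulr_ge0// ge_max.
move: a1 a2; set a := 2 / k1%:R; set b := 2 / (N - k1)%:R => a1 a2.
have h1 := mulr_ge0 a1 S20; have h2 := mulr_ge0 a2 S10.
have h3 := mulr_ge0 a1 S10; have h4 := mulr_ge0 a2 S20.
by apply/andP; split; lra.
Qed.

End Magnetization.

(** * Expectation over graph, initial state and dynamics *)

Section Expectation.
Variables (R : realType) (N k1 : nat) (pin pout P eta alphan tau : R) (beta : \bar R).
Hypothesis pin01 : 0 <= pin <= P.
Hypothesis pout01 : 0 <= pout <= P.
Hypothesis P_le1 : P <= 1.
Hypothesis eta_gt0 : 0 < eta.
Hypothesis eta_le1 : eta <= 1.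
Hypothesis beta_gt0 : (0 < beta)%E.
Hypothesis tau_ge0 : 0 <= tau.
Implicit Types F : config N -> R.

Local Notation E := (@dyn_expect R N k1 pin pout eta alphan beta tau).

Lemma transition_ge0 (G : graph N) s r : 0 <= transition G alphan beta tau s r.
Proof.
apply: (@exp_kernel_ge0 _ _ (generator G alphan beta) N.+1%:R) => //.
- exact: generator_unif_ge0.
- exact: generator_row0.
by rewrite ler1n.
Qed.

Let weight_ge0 (G : graph N) s0 s :
  0 <= graph_law k1 pin pout G * init_law k1 eta s0 * transition G alphan beta tau s0 s.
Proof.
rewrite mulr_ge0 ?transition_ge0// mulr_ge0 ?init_law_ge0//.
exact: graph_law_ge0 pin01 pout01 P_le1 G.
Qed.

Lemma dyn_expect_mono F F' : (forall s, F s <= F' s) -> E F <= E F'.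
Proof.
move=> FF; do 3![apply: ler_sum => ? _].
by apply: ler_wpM2l => //; exact: weight_ge0.
Qed.

Lemma dyn_expect_ge0 F : (forall s, 0 <= F s) -> 0 <= E F.
Proof.
move=> F0; do 3![apply: sumr_ge0 => ? _].
by rewrite mulr_ge0// weight_ge0.
Qed.

Lemma dyn_expectZ (c : R) F : E (fun s => c * F s) = c * E F.
Proof.
rewrite /dyn_expect; do 3![rewrite mulr_sumr; apply: eq_bigr => ? _].
by rewrite mulrCA.
Qed.

Lemma dyn_expect_markov F (eps : R) : 0 < eps -> (forall s, 0 <= F s) ->
  E (fun s => ((eps < F s)%R)%:R) <= eps^-1 * E F.
Proof.
move=> eps0 F0; rewrite -dyn_expectZ; apply: dyn_expect_mono => s.
case: ltP => h; last by rewrite mulr_ge0// invr_ge0 ltW.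
by rewrite mulrC ler_pdivlMr// mul1r ltW.
Qed.

Variables (C H M th : R).
Hypothesis k1_gt0 : (0 < k1)%N.
Hypothesis k1_ltN : (k1 < N)%N.
Hypothesis H_gt0 : 0 < H.
Hypothesis coupling_sum : forall k, H <= \sum_(v < N) coupling k1 pin pout alphan k v.
Hypothesis coupling_le : forall k (v : 'I_N), `|coupling k1 pin pout alphan k v| <= C.
Hypothesis C_ge0 : 0 <= C.
Hypothesis C_small : 4 * C <= eta * H.
Hypothesis M_ge0 : 0 <= M.
Hypothesis th04 : 0 <= th <= 4^-1.

Let A : R := 2 / k1%:R + 2 / (N - k1)%:R.

(** On good graphs [good_graph_bound] applies to every initial state; on bad graphs the count is at
    most [N]. Graph and initial state are independent, so their averages are taken separately. *)
Lemma dyn_expect_err :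
  E (err R k1) <= A * (expR (- tau) * N%:R + flip_error N eta beta H M
      + N%:R * (8 * (C / (eta * H / 2)) ^+ 2 * N%:R)
      + N%:R * barrier_rate N eta beta C H M * tau)
    + 2 * A * N%:R * (4 ^+ N * expR (8 * th ^+ 2 * P * N%:R ^+ 2 - th * M)).
Proof.
have A0 : 0 <= A by rewrite addr_ge0// divr_ge0.
have AN0 : 0 <= 2 * A * N%:R by rewrite !mulr_ge0.
pose X : R := expR (- tau) * N%:R + flip_error N eta beta H M
  + N%:R * barrier_rate N eta beta C H M * tau.
pose bar (s : config N) := barrier k1 pin pout alphan eta H s.
have X0 : 0 <= X.
  have r0 := barrier_rate_ge0 N beta C eta_gt0 H_gt0 M_ge0.
  have e0 := flip_error_ge0 N beta eta_gt0 H_gt0 M_ge0.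
  have d0 : 0 <= expR (- tau) * N%:R :> R by rewrite mulr_ge0// expR_ge0.
  by apply: addr_ge0; [exact: addr_ge0|rewrite mulr_ge0// mulr_ge0].
have inner (G : graph N) s0 : \sum_s transition G alphan beta tau s0 s * err R k1 s <=
    A * X + A * N%:R * bar s0 + 2 * A * N%:R * (~~ good_graph k1 pin pout M G)%:R.
  have B0 := @generator_unif_ge0 _ _ G alphan _ beta_gt0.
  have Q0 := generator_row0 G alphan beta.
  have L1 : 1 <= N.+1%:R :> R by rewrite ler1n.
  apply: (@le_trans _ _ (A * \sum_s transition G alphan beta tau s0 s * num_mismatch R k1 s)).
    rewrite mulr_sumr; apply: ler_sum => s _; rewrite mulrCA ler_wpM2l ?transition_ge0//.
    exact: err_le_mismatch.
  have [good|bad] := boolP (good_graph k1 pin pout M G).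
    rewrite mulr0 addr0 -mulrA -mulrDr ler_wpM2l//.
    have dl s : \sum_u `|deviation k1 pin pout G s u| <= M by exact: (forallP good s).
    have := good_graph_bound beta_gt0 eta_gt0 eta_le1 H_gt0 coupling_sum coupling_le
       C_ge0 C_small M_ge0 dl s0 tau_ge0.
    by rewrite /X /bar; lra.
  apply: (@le_trans _ _ (2 * A * N%:R)); last first.
    rewrite mulr1 lerDr; apply: addr_ge0; first exact: mulr_ge0.
    by apply: mulr_ge0; [exact: mulr_ge0|exact: barrier_ge0].
  rewrite [2 * A]mulrC -mulrA ler_wpM2l//.
  apply: (@le_trans _ _ (\sum_s exp_kernel (generator G alphan beta) tau s0 s * N%:R)).
    by apply: (exp_kernel_mono B0 Q0 L1) => // s; exact: num_mismatch_le.
  (* Applied to the constant [N] with [e = N], it bounds the row sum times [N] by [2 * N]; this is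
     the source of the factor 2 in the bad-graph term. *)
  have := @semigroup_bound _ _ _ _ B0 Q0 L1 (fun=> N%:R) (fun=> 0) N%:R 0.
  move/(_ (fun=> ler0n _ _) (fun=> lexx _) (ler0n _ _) (lexx _)).
  have Qc (c : R) s : kernel_op (generator G alphan beta) (fun=> c) s = 0.
    by rewrite /kernel_op -mulr_suml Q0 mul0r.
  move/(_ _ _ tau s0 tau_ge0) => h; apply: (le_trans (h _ _)).
  - by move=> s; rewrite Qc; lra.
  - by move=> s; rewrite Qc.
  have : expR (- tau) <= 1 by rewrite -(expR0 R) ler_expR oppr_le0.
  have N0 := ler0n R N.
  by move=> e; have := ler_wpM2r N0 e; lra.
apply: (@le_trans _ _ (\sum_(G : graph N) \sum_(s0 : config N)
   graph_law k1 pin pout G * init_law k1 eta s0 *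
   (A * X + A * N%:R * bar s0 + 2 * A * N%:R * (~~ good_graph k1 pin pout M G)%:R))).
  rewrite /dyn_expect; apply: ler_sum => G _; apply: ler_sum => s0 _.
  under eq_bigr do rewrite -mulrA; rewrite -mulr_sumr ler_wpM2l//.
  by rewrite mulr_ge0 ?init_law_ge0//; exact: graph_law_ge0 pin01 pout01 P_le1 G.
have -> : \sum_(G : graph N) \sum_(s0 : config N)
   graph_law k1 pin pout G * init_law k1 eta s0 *
   (A * X + A * N%:R * bar s0 + 2 * A * N%:R * (~~ good_graph k1 pin pout M G)%:R) =
   A * X + A * N%:R * (\sum_s0 init_law k1 eta s0 * bar s0)
   + 2 * A * N%:R * \sum_(G : graph N) graph_law k1 pin pout G * (~~ good_graph k1 pin pout M G)%:R.
  transitivity (\sum_(G : graph N) graph_law k1 pin pout G *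
    (A * X + A * N%:R * (\sum_s0 init_law k1 eta s0 * bar s0) +
     2 * A * N%:R * (~~ good_graph k1 pin pout M G)%:R)).
    apply: eq_bigr => G _; under eq_bigr do rewrite -mulrA.
    rewrite -mulr_sumr; congr (_ * _).
    set c := 2 * A * N%:R * _; set d := A * X; set e := A * N%:R.
    transitivity (\sum_(s0 : config N) (init_law k1 eta s0 * (d + c) + e * (init_law k1 eta s0 * bar s0))).
      by apply: eq_bigr => s0 _; ring.
    by rewrite big_split /= -mulr_suml init_law_sum1 -mulr_sumr; ring.
  set d := A * X + _; set c := 2 * A * N%:R.
  transitivity (\sum_(G : graph N) (graph_law k1 pin pout G * d +
     c * (graph_law k1 pin pout G * (~~ good_graph k1 pin pout M G)%:R))).
    by apply: eq_bigr => G _; ring.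
  by rewrite big_split /= -mulr_suml graph_law_sum1 -mulr_sumr; ring.
have h1 := initial_barrier eta_gt0 eta_le1 H_gt0 coupling_le.
have h2 := @bad_graph_prob _ N k1 _ _ _ pin01 pout01 P_le1 _ M th04.
have h3 := ler_wpM2l AN0 h2.
have h4 := ler_wpM2l (mulr_ge0 A0 (ler0n R N)) h1.
apply: lerD => //.
apply: (le_trans (lerD (lexx _) h4)).
by rewrite le_eqVlt; apply/orP; left; apply/eqP; rewrite /X; ring.
Qed.

End Expectation.

(** * Explicit rate of convergence *)

Section ConvergenceRate.
Variables (R : realType) (a b alpha eta c h m A : R).
Hypothesis b_gt0 : 0 < b.
Hypothesis b_lt_a : b < a.
Hypothesis eta_gt0 : 0 < eta.
Hypothesis eta_le1 : eta <= 1.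
Hypothesis c_gt0 : 0 < c.
Hypothesis c_lt4 : c < 4^-1.
Hypothesis h_gt0 : 0 < h.
Hypothesis m_gt0 : 0 < m.
Hypothesis A_gt0 : 0 < A.

Let a_gt0 : 0 < a := lt_trans b_gt0 b_lt_a.

Variables (n V1 V2 : nat) (lam : R) (beta : \bar R).
Hypothesis n_gt0 : (0 < n)%N.
Hypothesis lam_ge1 : 1 <= lam.
Hypothesis pin_le1 : a * lam / n%:R <= 1.
Hypothesis V1_ge : m * n%:R <= V1%:R.
Hypothesis V2_ge : m * n%:R <= V2%:R.
Hypothesis V_le : (V1 + V2)%:R <= A * n%:R.
Hypothesis field1 : h * n%:R <= V1%:R * (a - alpha) + V2%:R * (alpha - b).
Hypothesis field2 : h * n%:R <= V2%:R * (a - alpha) + V1%:R * (alpha - b).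
Hypothesis n_large : 4 * (a + `|alpha|) <= eta * h * n%:R.
Hypothesis beta_gt0 : (0 < beta)%E.
Hypothesis rate_small : rate beta (2 * (eta * (h * lam) / 8)) <= lam^-1.

Local Notation N := (V1 + V2)%N.
Local Notation pin := (a * lam / n%:R).
Local Notation pout := (b * lam / n%:R).
Local Notation alphan := (alpha * lam / n%:R).
Let l : R := ln lam.
Let w : R := expR (- (c * l)).
(** Here [g / n] is the ratio [C / theta], [K1] bounds the error prefactor times [N], and [K4], [K5]
    are the constants in [flip_error <= K4 n lam^(-1/2)] and [barrier_rate <= K5 lam^(-1/2)]. *)
Let c0 : R := a + `|alpha|.
Let g : R := 2 * c0 / (eta * h).
Let K1 : R := 4 * A / m.
(** A quarter of it exceeds by 1 the sum of the union-bound cost [3 * A] and the exponential moment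
    cost [a * A ^ 2 / 2], both per unit of [n], so bad graphs have probability at most
    [exp(- n)]. *)
Let K2 : R := 4 * (3 * A + a * A ^+ 2 / 2 + 1).
Let K4 : R := A + 8 * K2 / (eta * h).
Let K5 : R := A * g ^+ 2 * (16 * K4 + 8 / a).

Let n0 : 0 < n%:R :> R. Proof. by rewrite ltr0n. Qed.
Let lam0 : 0 < lam. Proof. exact: lt_le_trans ltr01 lam_ge1. Qed.
Let l0 : 0 <= l. Proof. exact: ln_ge0. Qed.
Let eh0 : 0 < eta * h. Proof. exact: mulr_gt0. Qed.
Let c00 : 0 < c0. Proof. by rewrite ltr_pwDl. Qed.
Let g0 : 0 < g. Proof. by rewrite divr_gt0// mulr_gt0. Qed.
Let K10 : 0 < K1. Proof. by rewrite divr_gt0// mulr_gt0. Qed.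
Let K20 : 0 < K2.
Proof. by rewrite mulr_gt0// addr_gt0// addr_gt0 ?divr_gt0 ?mulr_gt0 ?exprn_gt0. Qed.
Let K40 : 0 < K4. Proof. by rewrite addr_gt0// divr_gt0// mulr_gt0. Qed.
Let V10 : 0 < V1%:R :> R. Proof. by apply: lt_le_trans V1_ge; exact: mulr_gt0. Qed.
Let V20 : 0 < V2%:R :> R. Proof. by apply: lt_le_trans V2_ge; exact: mulr_gt0. Qed.
Let K50 : 0 < K5.
Proof.
apply: mulr_gt0; first by rewrite mulr_gt0 ?exprn_gt0.
by rewrite addr_gt0// ?divr_gt0// mulr_gt0.
Qed.

Let w_lam (x : R) : c <= x -> expR (- (x * l)) <= w.
Proof. by move=> cx; rewrite ler_expR lerN2 ler_wpM2r. Qed.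

Let lamE : expR l = lam. Proof. by rewrite lnK// posrE. Qed.

Let lamV : lam^-1 = expR (- (1 * l)). Proof. by rewrite mul1r expRN lamE. Qed.

(** Edge probabilities at most 1 force [a * lam <= n]; finite-size errors of order [1 / n] thus
    become errors in [lam]. *)
Lemma inv_n_le : n%:R^-1 <= a^-1 * lam^-1.
Proof.
rewrite -invfM lef_pV2 ?posrE ?mulr_gt0//.
by move: pin_le1; rewrite ler_pdivrMr// mul1r.
Qed.

Let hl (k : bool) : h * lam <= \sum_(v < N) coupling V1 pin pout alphan k v.
Proof.
have V1N : (V1 < N)%N by rewrite -addn1 leq_add2l -(ltr0n R).
have s1 := card_incomm1 R V1N.
have := card_incomm2 R V1N; rewrite addKn => s2.
have -> : \sum_(v < N) coupling V1 pin pout alphan k v =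
   (if k then V1%:R * (a - alpha) + V2%:R * (alpha - b)
    else V2%:R * (a - alpha) + V1%:R * (alpha - b)) * (lam / n%:R).
  rewrite (bigID (fun v : 'I_N => incomm1 V1 v)) /=.
  rewrite (eq_bigr (fun=> 1 * (if k then pin - alphan else alphan - pout))); last first.
    by move=> v hv; rewrite /coupling hv mul1r; case: k.
  rewrite [X in _ + X](eq_bigr (fun=> 1 * (if k then alphan - pout else pin - alphan))); last first.
    by move=> v /negbTE hv; rewrite /coupling hv mul1r; case: k.
  rewrite -!mulr_suml s1 s2; case: k; ring.
have -> : h * lam = h * n%:R * (lam / n%:R) by field; exact: lt0r_neq0.
apply: ler_wpM2r; first by rewrite divr_ge0// ltW.
by case: k.
Qed.

Let cl (k : bool) (v : 'I_N) : `|coupling V1 pin pout alphan k v| <= c0 * lam / n%:R.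
Proof.
have x0 : 0 <= lam / n%:R by rewrite divr_ge0// ltW.
have e (p r : R) : `|p * lam / n%:R - r * lam / n%:R| = `|p - r| * (lam / n%:R).
  by rewrite -!mulrA -mulrBl normrM [`|lam / _|]ger0_norm.
rewrite /coupling -[c0 * _ / _]mulrA; case: ifP => _; rewrite e; apply: ler_wpM2r => //;
  apply: (le_trans (ler_normB _ _)); rewrite /c0.
  by rewrite [`|a|]gtr0_norm.
rewrite [`|b|]gtr0_norm//; move: b_lt_a; lra.
Qed.

(** The summands bound, in order, the decay term, the flip error, the initial barrier, the barrier
    drift and the bad graphs. *)
Definition rate_const : R :=
  K1 + 4 / m * K4 + 8 * K1 * A * g ^+ 2 / a + 4 * c * K1 * K5 + 2 * K1 / a.

Lemma dyn_expect_err_rate :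
  dyn_expect V1 pin pout eta alphan beta (c * l) (err R V1 : config N -> R) <=
  rate_const * w.
Proof.
rewrite /rate_const.
have w0 : 0 < w by exact: expR_gt0.
have tau0 : 0 <= c * l by rewrite mulr_ge0// ltW.
have h2le : expR (- (2^-1 * l)) <= w by apply: w_lam; move: c_lt4; lra.
have h1le : lam^-1 <= w by rewrite lamV; apply: w_lam; move: c_lt4; lra.
have lamV2 : lam^-1 <= expR (- (2^-1 * l)).
  by rewrite lamV ler_expR lerN2 ler_wpM2r//; lra.
set e2 := expR (- (2^-1 * l)) in h2le lamV2.
have e20 : 0 < e2 by exact: expR_gt0.
have lame2 : lam * (e2 * e2) = 1.
  rewrite /e2 -{1}lamE -!expRD -[RHS](expR0 R); congr expR; lra.
(* [M] has order [n lam^(1/2)] and [th] is [lam^(-1/2) / 4], so that [th * M = K2 * n / 4] and the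
   exponential moment bound also has an exponent of order [n]. *)
pose M : R := K2 * n%:R * expR (2^-1 * l).
pose th : R := e2 / 4.
have e2M : e2 * expR (2^-1 * l) = 1 by rewrite /e2 -expRD addNr expR0.
have M0 : 0 <= M.
  by apply: mulr_ge0; [apply: mulr_ge0; exact: ltW|exact: expR_ge0].
have th04 : 0 <= th <= 4^-1.
  have e21 : e2 <= 1 by rewrite -[X in _ <= X](expR0 R) ler_expR oppr_le0 mulr_ge0.
  by apply/andP; split; rewrite /th; lra.
have hH : 0 < h * lam by exact: mulr_gt0.
have x0 : 0 <= lam / n%:R by rewrite divr_ge0// ltW.
have p1 : 0 <= pin <= pin by rewrite lexx andbT -mulrA mulr_ge0// ltW.
have p2 : 0 <= pout <= pin.
  rewrite -!mulrA mulr_ge0 ?(ltW b_gt0)//=; apply: ler_wpM2r => //; exact: ltW.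
have C0 : 0 <= c0 * lam / n%:R by rewrite -mulrA mulr_ge0// ltW.
have Csm : 4 * (c0 * lam / n%:R) <= eta * (h * lam).
  have -> : 4 * (c0 * lam / n%:R) = (4 * c0) * (lam / n%:R) by ring.
  have -> : eta * (h * lam) = (eta * h * n%:R) * (lam / n%:R) by field; exact: lt0r_neq0.
  exact: ler_wpM2r.
have k10 : (0 < V1)%N by rewrite -(ltr0n R).
have k1N : (V1 < N)%N by rewrite -addn1 leq_add2l -(ltr0n R).
have fin := @dyn_expect_err R N V1 pin pout pin eta alphan (c * l) beta p1 p2 pin_le1
   eta_gt0 eta_le1 beta_gt0 tau0 _ _ M th k10 k1N hH hl cl C0 Csm M0 th04.
apply: (le_trans fin) => {fin}; rewrite addKn.
set AA := 2 / V1%:R + 2 / V2%:R.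
set fe := flip_error _ _ _ _ _.
set br := barrier_rate _ _ _ _ _ _.
have AA0 : 0 <= AA by rewrite addr_ge0// divr_ge0// ltW.
have N0 : 0 <= N%:R :> R by [].
have AAn : AA * n%:R <= 4 / m.
  have f (V : nat) : m * n%:R <= V%:R -> 2 / V%:R * n%:R <= 2 / m :> R.
    move=> hV; have V0 : 0 < V%:R :> R by apply: lt_le_trans hV; exact: mulr_gt0.
    by rewrite mulrAC ler_pdivrMr// mulrAC ler_pdivlMr// -mulrA (mulrC _ m) ler_pM2l.
  by have := f _ V1_ge; have := f _ V2_ge; rewrite /AA mulrDl; lra.
have AN : AA * N%:R <= K1.
  apply: (le_trans (ler_wpM2l AA0 V_le)); rewrite mulrCA /K1 [4 * A]mulrC -mulrA.
  by apply: ler_wpM2l => //; exact: ltW.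
have AN0 : 0 <= AA * N%:R by exact: mulr_ge0.
have Cth : N%:R * (c0 * lam / n%:R / (eta * (h * lam) / 2)) ^+ 2 <= A * g ^+ 2 / n%:R.
  have -> : c0 * lam / n%:R / (eta * (h * lam) / 2) = g / n%:R.
    by rewrite /g; field; rewrite !lt0r_neq0.
  have -> : A * g ^+ 2 / n%:R = A * n%:R * (g / n%:R) ^+ 2 by field; exact: lt0r_neq0.
  by apply: ler_wpM2r => //; exact: sqr_ge0.
have Ag0 : 0 <= A * g ^+ 2 by rewrite mulr_ge0 ?sqr_ge0// ltW.
have ne2 : n%:R^-1 <= e2 / a.
  by apply: (le_trans inv_n_le); rewrite mulrC ler_wpM2r// invr_ge0 ltW.
have feb : fe <= n%:R * (K4 * e2).
  have r1 : N%:R * rate beta (2 * (eta * (h * lam) / 8)) <= A * n%:R * e2.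
    by apply: ler_pM => //; [exact: rate_ge0|exact: le_trans rate_small lamV2].
  (* The averaged field is of order [lam] and the deviations sum to order [n lam^(1/2)], so the
     ratio is of order [n lam^(-1/2)]. *)
  have r2 : M / (eta * (h * lam) / 8) = n%:R * (8 * K2 / (eta * h) * e2).
    rewrite /M -[lam in LHS]mulr1 -[X in lam * X]e2M.
    have lamh : lam * (e2 * expR (2^-1 * l)) = expR (2^-1 * l) * (lam * e2) by ring.
    have ne : lam * e2 != 0 by rewrite mulf_neq0// lt0r_neq0.
    have ee : e2 = (lam * e2)^-1 by apply: (mulfI ne); rewrite mulfV// mulrAC -mulrA lame2.
    rewrite lamh [in RHS]ee; field.
    by rewrite !lt0r_neq0// ?mulr_gt0// expR_gt0.
  rewrite /fe /flip_error r2 /K4; move: r1; set r := rate _ _.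
  by set q := 8 * K2 / (eta * h) => r1; have := r1; lra.
have fe0 : 0 <= fe by exact: flip_error_ge0.
have brb : br <= K5 * e2.
  rewrite /br /barrier_rate -/fe [_ ^+ 2 * _]mulrC.
  have fe16 : 16 * fe + 8 <= n%:R * (16 * K4 * e2 + 8 * (e2 / a)).
    have : n%:R * n%:R^-1 <= n%:R * (e2 / a) by rewrite ler_pM2l.
    by rewrite mulfV ?lt0r_neq0//; move: feb; lra.
  apply: (@le_trans _ _ (A * g ^+ 2 / n%:R * (n%:R * (16 * K4 * e2 + 8 * (e2 / a))))).
    apply: ler_pM => //; first by rewrite mulr_ge0// sqr_ge0.
    by rewrite addr_ge0// mulr_ge0.
  rewrite le_eqVlt; apply/orP; left; apply/eqP; rewrite /K5.
  by field; rewrite !lt0r_neq0.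
have brt : br * (c * l) <= 4 * c * K5 * w.
  apply: (@le_trans _ _ (K5 * e2 * (c * l))); first by apply: ler_wpM2r.
  (* The logarithm from the time horizon costs [lam^(1/4)], leaving [lam^(-1/4)] out of
     [lam^(-1/2)]; this is where [c < 1/4] enters. *)
  have le4 : l <= 4 * expR (4^-1 * l) by have := expR_ge1Dx (4^-1 * l); lra.
  have e4 : e2 * expR (4^-1 * l) = expR (- (4^-1 * l)).
    by rewrite /e2 -expRD; congr expR; lra.
  have w4 : expR (- (4^-1 * l)) <= w by apply: w_lam; exact: ltW.
  have -> : K5 * e2 * (c * l) = c * K5 * (e2 * l) by ring.
  have -> : 4 * c * K5 * w = c * K5 * (4 * w) by ring.
  apply: ler_wpM2l; first by rewrite mulr_ge0 ?ltW.
  apply: (le_trans (ler_wpM2l (ltW e20) le4)).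
  by rewrite mulrCA e4 ler_pM2l.
have bad : 4 ^+ N * expR (8 * th ^+ 2 * pin * N%:R ^+ 2 - th * M) <= w / a.
  have -> : th * M = K2 / 4 * n%:R.
    transitivity (K2 / 4 * n%:R * (e2 * expR (2^-1 * l))); last by rewrite e2M mulr1.
    by rewrite /th /M; set K := K2; ring.
  have q8 : 8 * th ^+ 2 * pin * N%:R ^+ 2 <= a * A ^+ 2 / 2 * n%:R.
    have -> : 8 * th ^+ 2 * pin * N%:R ^+ 2 = a / 2 / n%:R * N%:R ^+ 2 * (lam * (e2 * e2)).
      by rewrite /th; field; exact: lt0r_neq0.
    rewrite lame2 mulr1.
    have -> : a * A ^+ 2 / 2 * n%:R = a / 2 / n%:R * (A * n%:R) ^+ 2.
      by field; exact: lt0r_neq0.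
    apply: ler_wpM2l; first by rewrite !divr_ge0// ltW.
    by rewrite lerXn2r ?nnegrE// mulr_ge0// ltW.
  have p4 : 4 ^+ N <= expR (3 * N%:R) :> R.
    rewrite expRM_natr lerXn2r ?nnegrE ?expR_ge0//.
    by have := expR_ge1Dx (3 : R); lra.
  apply: (@le_trans _ _ (expR (3 * N%:R) * expR (a * A ^+ 2 / 2 * n%:R - K2 / 4 * n%:R))).
    by apply: ler_pM => //; rewrite ?exprn_ge0 ?expR_ge0// ler_expR lerD2r.
  apply: (@le_trans _ _ (expR (- n%:R))).
    by rewrite -expRD ler_expR /K2; move: V_le; lra.
  apply: (@le_trans _ _ (n%:R^-1)).
    rewrite expRN lef_pV2 ?posrE ?expR_gt0//.
    by have := expR_ge1Dx (n%:R : R); lra.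
  by apply: (le_trans ne2); rewrite ler_wpM2r// invr_ge0 ltW.
set BAD := 4 ^+ N * _ in bad *.
have t1 : AA * N%:R * w <= K1 * w by rewrite ler_pM2r.
have t2 : AA * fe <= 4 / m * K4 * w.
  apply: (le_trans (ler_wpM2l AA0 feb)); rewrite (mulrA AA) -(mulrA (4 / m)).
  by apply: ler_pM; [apply: mulr_ge0; [exact: AA0|exact: ltW]|apply: mulr_ge0; exact: ltW|exact: AAn|rewrite ler_pM2l].
have t3 : AA * (N%:R * (8 * (c0 * lam / n%:R / (eta * (h * lam) / 2)) ^+ 2 * N%:R))
     <= 8 * K1 * A * g ^+ 2 / a * w.
  move: Cth; set q := _ ^+ 2 => Cth.
  have -> : AA * (N%:R * (8 * q * N%:R)) = 8 * ((AA * N%:R) * (N%:R * q)) by ring.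
  have -> : 8 * K1 * A * g ^+ 2 / a * w = 8 * (K1 * (A * g ^+ 2 * (w / a))).
    by set ia := a^-1; ring.
  rewrite ler_pM2l//; apply: ler_pM => //; first by rewrite mulr_ge0// sqr_ge0.
  apply: (le_trans Cth); apply: ler_wpM2l => //; apply: (le_trans ne2).
  by rewrite ler_wpM2r// invr_ge0 ltW.
have br0 : 0 <= br by exact: barrier_rate_ge0.
have t4 : AA * (N%:R * br * (c * l)) <= 4 * c * K1 * K5 * w.
  have -> : AA * (N%:R * br * (c * l)) = (AA * N%:R) * (br * (c * l)) by ring.
  have -> : 4 * c * K1 * K5 * w = K1 * (4 * c * K5 * w) by ring.
  by apply: ler_pM => //; rewrite mulr_ge0.
have BAD0 : 0 <= BAD by rewrite mulr_ge0 ?exprn_ge0// expR_ge0.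
have t5 : 2 * AA * N%:R * BAD <= 2 * K1 / a * w.
  have -> : 2 * AA * N%:R * BAD = 2 * ((AA * N%:R) * BAD) by ring.
  have -> : 2 * K1 / a * w = 2 * (K1 * (w / a)) by set ia := a^-1; ring.
  by rewrite ler_pM2l//; apply: ler_pM.
rewrite 3!(mulrDr AA) 4!(mulrDl _ _ w) -/w [w * N%:R]mulrC (mulrA AA N%:R w).
by do 4!apply: lerD => //.
Qed.

End ConvergenceRate.

(** * Low temperature and passage to the limit *)

(** For finite [beta] the hypothesis says [beta * k * lam >= ln lam], so the exponential in the rate
    is at least [lam]; for infinite [beta] the rate vanishes at positive arguments. *)
Lemma rate_le_inv (R : realType) (beta : \bar R) (lam k : R) :
  (0 < beta)%E -> 1 < lam -> 0 < k ->
  ((k^-1)%:E <= beta * (lam / ln lam)%:E)%E -> rate beta (k * lam) <= lam^-1.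
Proof.
move=> + lam1 k0; have lam0 : 0 < lam by apply: lt_trans lam1.
have l0 : 0 < ln lam by exact: ln_gt0.
case: beta => [b||] //=; last first.
  by move=> _ _; rewrite gt_eqF ?mulr_gt0// ltNge (ltW (mulr_gt0 k0 lam0)) /= mulr0 addr0 invr_ge0 ltW.
move=> _; rewrite lee_fin [b * (lam / _)]mulrA ler_pdivlMr// ler_pdivrMl// => h.
rewrite lef_pV2 ?posrE ?addr_gt0 ?expR_gt0//.
rewrite -[X in X <= _](@lnK _ lam) ?posrE//.
apply: (@le_trans _ _ (expR (b * (k * lam)))); last by rewrite lerDr.
by rewrite ler_expR mulrCA.
Qed.


Unset Implicit Arguments.

(** Convergence in probability is expressed through the expected indicator of [eps < err]. The
    eventual bound on [a * lam n / n%:R] says that the edge parameters are probabilities. *)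
Theorem theorem3p2 (R : realType) (a b alpha eta v1 v2 c : R)
  (lam : nat -> R) (V1 V2 : nat -> nat) (beta : nat -> \bar R) :
  0 < b -> b < a -> 0 < eta -> eta <= 1 ->
  lam n @[n --> \oo] --> +oo ->
  (\forall n \near \oo, a * lam n / n%:R <= 1) ->
  (V1 n)%:R / n%:R @[n --> \oo] --> v1 ->
  (V2 n)%:R / n%:R @[n --> \oo] --> v2 ->
  0 < v2 -> v2 <= v1 ->
  (v2 < v1 -> (b * v1 - a * v2) / (v1 - v2) < alpha
              /\ alpha < (a * v1 - b * v2) / (v1 - v2)) ->
  (forall n, (0 < beta n)%E) ->
  (beta n * (lam n / ln (lam n))%:E)%E @[n --> \oo] --> +oo%E ->
  0 < c -> c < 4^-1 ->
  let E := fun n (F : config (V1 n + V2 n) -> R) =>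
    dyn_expect (V1 n) (a * lam n / n%:R) (b * lam n / n%:R) eta
      (alpha * lam n / n%:R) (beta n) (c * ln (lam n)) F in
  (forall eps : R, 0 < eps ->
     E n (fun s => ((eps < err R (V1 n) s)%R)%:R) @[n --> \oo] --> 0)
  /\ E n (fun s => err R (V1 n) s) @[n --> \oo] --> 0.
Proof.
move=> b0 ba eta0 eta1 lamy pin1 cV1 cV2 v20 v21 alphaP beta0 betay c0 c4 E.
have a0 : 0 < a by exact: lt_trans ba.
have v10 : 0 < v1 by exact: lt_le_trans v21.
(* Positivity of the two limiting fields is the condition on [alpha] with denominators cleared; for
   equal sizes both fields are [v2 * (a - b)]. *)
have [h1 h2] : 0 < v1 * (a - alpha) + v2 * (alpha - b) /\
               0 < v2 * (a - alpha) + v1 * (alpha - b).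
  have [lt|le] := ltP v2 v1.
    have [] := alphaP lt; have d0 : 0 < v1 - v2 by rewrite subr_gt0.
    rewrite ltr_pdivrMr// ltr_pdivlMr// => u1 u2; split; lra.
  have <- : v2 = v1 by apply/eqP; rewrite eq_le v21 le.
  have : 0 < v2 * (a - b) by rewrite mulr_gt0// subr_gt0.
  by split; lra.
(* Half the smaller limiting field leaves a margin, so that the fields at finite [n] eventually
   exceed [h * n]. *)
pose h := Num.min (v1 * (a - alpha) + v2 * (alpha - b)) (v2 * (a - alpha) + v1 * (alpha - b)) / 2.
have h0 : 0 < h by rewrite divr_gt0// lt_min h1.
(* [v2 / 2] bounds both community fractions from below eventually, as [v2 <= v1]; [v1 + v2 + 1]
   bounds their sum from above. *)
pose K := `|rate_const a alpha eta c h (v2 / 2) (v1 + v2 + 1)| + 1.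
have K0 : 0 < K by rewrite ltr_pwDr.
have err0 n (s : config (V1 n + V2 n)) : 0 <= err R (V1 n) s by rewrite le_max normr_ge0.
have cf (x y : R) (V V' : nat -> nat) (v v' : R) : (V n)%:R / n%:R @[n --> \oo] --> v ->
    (V' n)%:R / n%:R @[n --> \oo] --> v' ->
    (V n)%:R / n%:R * x + (V' n)%:R / n%:R * y @[n --> \oo] --> v * x + v' * y.
  by move=> cV cV'; apply: cvgD; apply: cvgM => //; exact: cvg_cst.
pose bounded n := [/\ 0 <= a * lam n / n%:R <= 1,
    0 <= b * lam n / n%:R <= a * lam n / n%:R, 0 <= c * ln (lam n) &
    E n (fun s => err R (V1 n) s) <= K * expR (- (c * ln (lam n)))].
have bound : \forall n \near \oo, bounded n.
  have lam1 : \forall n \near \oo, 2 <= lam n by move/cvgryPge : lamy; apply.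
  have nb : \forall n \near \oo, (eta * h)^-1 * (4 * (a + `|alpha|)) <= n%:R.
    exact: nbhs_infty_ger.
  have np : \forall n \near \oo, (0 < n)%N by exact: nbhs_infty_gt.
  have bt : \forall n \near \oo, (((eta * h / 4)^-1)%:E <= beta n * (lam n / ln (lam n))%:E)%E.
    by move/cvgeyPge : betay; apply.
  have w1 : \forall n \near \oo, v2 / 2 <= (V1 n)%:R / n%:R by apply: cvgr_ge cV1 _ _; lra.
  have w2 : \forall n \near \oo, v2 / 2 <= (V2 n)%:R / n%:R by apply: cvgr_ge cV2 _ _; lra.
  have w3 : \forall n \near \oo, (V1 n)%:R / n%:R + (V2 n)%:R / n%:R <= v1 + v2 + 1.
    by apply: (cvgr_le (v1 + v2)); [exact: cvgD|lra].
  have hlt : h < Num.min (v1 * (a - alpha) + v2 * (alpha - b))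
                         (v2 * (a - alpha) + v1 * (alpha - b)).
    by rewrite /h; move: h0; rewrite /h; lra.
  move: hlt; rewrite lt_min => /andP[hlt1 hlt2].
  have f1 := cvgr_ge _ (cf (a - alpha) (alpha - b) _ _ _ _ cV1 cV2) _ hlt1.
  have f2 := cvgr_ge _ (cf (a - alpha) (alpha - b) _ _ _ _ cV2 cV1) _ hlt2.
  near=> n.
  have n0 : (0 < n)%N by near: n.
  have nr0 : 0 < n%:R :> R by rewrite ltr0n.
  have ln2 : 2 <= lam n by near: n.
  have lamgt0 : 0 < lam n by exact: lt_le_trans ln2.
  have lam_ge1 : 1 <= lam n by lra.
  have x0 : 0 <= lam n / n%:R by rewrite divr_ge0// ltW.
  have p1 : a * lam n / n%:R <= 1 by near: n.
  split=> //.
  - by rewrite p1 andbT -mulrA mulr_ge0// ltW.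
  - by rewrite -!mulrA mulr_ge0 ?(ltW b0)//= ler_wpM2r// ltW.
  - by rewrite mulr_ge0 ?ln_ge0// ltW.
  apply: (@le_trans _ _ (rate_const a alpha eta c h (v2 / 2) (v1 + v2 + 1) *
      expR (- (c * ln (lam n))))); last first.
    rewrite ler_wpM2r ?expR_ge0//; apply: (le_trans (ler_norm _)).
    by rewrite lerDl.
  apply: dyn_expect_err_rate => //.
  - lra.
  - by rewrite addr_gt0// addr_gt0.
  - by rewrite -ler_pdivlMr//; near: n.
  - by rewrite -ler_pdivlMr//; near: n.
  - by rewrite -ler_pdivrMr// natrD mulrDl; near: n.
  - rewrite -ler_pdivlMr// mulrDl ![_ * (_ - _) / _]mulrAC; near: n; exact: f1.
  - rewrite -ler_pdivlMr// mulrDl ![_ * (_ - _) / _]mulrAC; near: n; exact: f2.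
  - by rewrite -ler_pdivrMl; [near: n|exact: mulr_gt0].
  have -> : 2 * (eta * (h * lam n) / 8) = eta * h / 4 * lam n by field.
  apply: rate_le_inv => //; first lra.
    by rewrite divr_gt0// mulr_gt0.
  by near: n.
have errto0 : E n (fun s => err R (V1 n) s) @[n --> \oo] --> 0.
  apply/cvgr0Pnorm_le => e e0.
  (* Above this threshold [c * ln lam >= K / e], hence [exp(c * ln lam) >= K / e] by
     [1 + x <= exp x]. *)
  have lbig : \forall n \near \oo, expR (c^-1 * (K / e)) <= lam n by move/cvgryPge : lamy; apply.
  near=> n.
  have [p1 p2 t0 hE] : bounded n by near: n.
  rewrite ger0_norm; last first.
    apply: (@dyn_expect_ge0 _ _ _ _ _ (a * lam n / n%:R)) => //.
    - by rewrite lexx andbT; case/andP: p1.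
    - by case/andP: p1.
  apply: (le_trans hE); rewrite expRN ler_pdivrMr ?expR_gt0// mulrC -ler_pdivrMr//.
  have lb : expR (c^-1 * (K / e)) <= lam n by near: n.
  have : c^-1 * (K / e) <= ln (lam n).
    rewrite -[X in X <= _]expRK ler_ln// ?posrE ?expR_gt0//.
    by apply: lt_le_trans lb; exact: expR_gt0.
  rewrite ler_pdivrMl// => h3.
  by have := expR_ge1Dx (c * ln (lam n)); lra.
split=> // eps eps0.
apply/cvgr0Pnorm_le => e e0.
(* By Markov, probability at most [e] follows from expected error at most [eps * e]. *)
have e'0 : 0 < eps * e by exact: mulr_gt0.
near=> n.
have [p1 p2 t0 hE] : bounded n by near: n.
have p1' : 0 <= a * lam n / n%:R <= a * lam n / n%:R by rewrite lexx andbT; case/andP: p1.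
have p1'' : a * lam n / n%:R <= 1 by case/andP: p1.
rewrite ger0_norm; last first.
  by apply: (@dyn_expect_ge0 _ _ _ _ _ (a * lam n / n%:R)).
have mk := @dyn_expect_markov R _ (V1 n) _ _ _ _ (alpha * lam n / n%:R) _ _ p1' p2 p1'' eta0 eta1 (beta0 n) t0 _
  _ eps0 (err0 n).
apply: (le_trans mk); rewrite ler_pdivrMl//.
apply: (le_trans (ler_norm _)).
by near: n; move/cvgr0Pnorm_le : errto0; apply.
Unshelve. all: by end_near.
Qed.
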